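(* Let $\mathcal{T}$ be a geometric positively oriented ideal triangulation, with $N$ tetrahedra, of an oriented hyperbolic 3-manifold $M$ with one cusp ($k=1$), let $\theta$ be an oriented homotopically non-trivial simple closed peripheral curve in normal position with respect to $\mathcal{T}$, and let $z=y_\theta(u)$, $u\in U$. Let $\mathbb{T}_1\in\mathbb{C}^*/\{\pm1\}$ be the torsion of the acyclic complex $$0\to T_uU\xrightarrow{Dy}T_z\mathbb{C}_{\mathrm{Im}>0}^N\xrightarrow{Dg}T_1(\mathbb{C}^* )^N\xrightarrow{Dp}\mathbb{C}\to0$$ (graded in degrees $0,1,2,3$) with respect to the bases $\{\partial/\partial u\}$, $\{\partial/\partial z_j\}_{j=1}^N$, $\{\partial/\partial x_i\}_{i=1}^N$, $\{1\}$. Then $$\mathbb{T}_1=\pm\tfrac12\det\bigl(\hat G\,\mathrm{diag}(\zeta)+\hat G'\,\mathrm{diag}(\zeta')+\hat G''\,\mathrm{diag}(\zeta'')\bigr).$$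
   Context: $\mathcal{T}$ has $N$ tetrahedra and $N$ edges $e_1,\dots,e_N$. Shapes $z_j\in\mathbb{C}_{\mathrm{Im}>0}$, $z'_j=1/(1-z_j)$, $z''_j=1-1/z_j$ label the three pairs of opposite edges of the $j$-th tetrahedron, compatibly with orientation; $G_{ij},G'_{ij},G''_{ij}$ count the edges of tetrahedron $j$ labelled $z_j,z'_j,z''_j$ identified to $e_i$. The map $g:\mathbb{C}_{\mathrm{Im}>0}^N\to(\mathbb{C}^* )^N$ is $g(z)=(\prod_jz_j^{G_{ij}}(z'_j)^{G'_{ij}}(z''_j)^{G''_{ij}})_{i}$ and $\mathcal{V}^+_{\mathcal{T}}=g^{-1}(1,\dots,1)$. The log-parameter along $\theta$ is $u(z)=\sum_jC_j\log z_j+C'_j\log z'_j+C''_j\log z''_j$ (standard branch), with $C_j,C'_j,C''_j$ the Neumann–Zagier signed counts of corners cut off by $\theta$ in the vertex link; the completeness equation is $u=0$. Let $z_*\in\mathcal{V}^+_{\mathcal{T}}$ be the solution giving the complete structure; $u$ is a holomorphic coordinate on $\mathcal{V}^+_{\mathcal{T}}$ near $z_*$, and $y=y_\theta:U\to\mathcal{V}^+_{\mathcal{T}}$ is its local inverse on a sufficiently small neighbourhood $U$ of $0\in\mathbb{C}$. The map $p:(\mathbb{C}^* )^N\to\mathbb{C}^*$ is $p(x_1,\dots,x_N)=\prod_ix_i^{2}$ (each edge has both ends at the only cusp), and $T_1\mathbb{C}^*$ is identified with $\mathbb{C}$. $x_1,\dots,x_N$ are the standard coordinates of $(\mathbb{C}^*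 )^N$. The displayed complex is exact by results of Neumann–Zagier and Choi. $\hat G,\hat G',\hat G''$ are the matrices $G,G',G''$ with the last row replaced by the rows $(C_j),(C'_j),(C''_j)$. $\zeta_j=1/z_j$, $\zeta'_j=1/(1-z_j)$, $\zeta''_j=1/(z_j(z_j-1))$. Torsion of an acyclic complex $C^\bullet$ with bases $\underline c^i$: choose bases $\underline b^i$ of the coboundary spaces $B^i\subset C^i$ and lifts $s^i(\underline b^{i+1})\subset C^i$; the torsion is $\pm\prod_i[\underline b^i\cup s^i(\underline b^{i+1}):\underline c^i]^{(-1)^i}$, where $[\underline a:\underline c]$ is the determinant expressing $\underline a$ in terms of $\underline c$. *)

(* Defs.v *)
From HB Require Import structures.
From mathcomp Require Import all_boot all_order all_fingroup all_algebra.
From mathcomp Require Import complex.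
From mathcomp Require Import all_classical all_reals all_analysis.

Set Implicit Arguments.
Unset Strict Implicit.
Unset Printing Implicit Defensive.

Import Order.TTheory GRing.Theory Num.Theory.
Import numFieldNormedType.Exports.

Local Open Scope classical_set_scope.
Local Open Scope ring_scope.

(* Complex numbers are [R[i]]. [R[i]^o] carries their normed and vector-space
   structure over themselves, so [differentiable] and ['d] mean complex
   differentiability and the complex-linear differential. *)

Notation v0 := (@Ordinal 4 0 isT).
Notation v1 := (@Ordinal 4 1 isT).
Notation v2 := (@Ordinal 4 2 isT).
Notation v3 := (@Ordinal 4 3 isT).

(* Indices of the shape parameters z, z', z''. *)
Notation sz := (@Ordinal 3 0 isT).
Notation sz' := (@Ordinal 3 1 isT).
Notation sz'' := (@Ordinal 3 2 isT).

(* An oriented ideal triangulation with N tetrahedra and N edges. The vertices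
   of each tetrahedron are numbered by ['I_4] so that (0,1,2,3) is positively
   oriented, i.e. (0,1,2,3) can be sent to (oo,0,1,z) with Im z > 0; face f is
   the one opposite to vertex f. If [glue j f = (k, s)], the face f of
   tetrahedron j is identified with the face [s f] of tetrahedron k by the
   restriction of [s] to the three vertices other than f. Gluing maps of
   oriented tetrahedra reverse the orientation of faces, hence are odd on
   vertex numbers. An edge of a tetrahedron is the set of its two end points.

   [edge] numbers the edges e_1, ..., e_N of the triangulation. With a
   connected vertex link, having as many edges as tetrahedra says that the
   Euler characteristic 2N - 6N + 4N of the link is zero, so that it is a
   torus. *)
Definition edge_glued N (glue : 'I_N -> 'I_4 -> 'I_N * 'S_4) :
    rel ('I_N * {set 'I_4}) :=
  fun x y => [exists f, (f \notin x.2) &&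
    (y == ((glue x.1 f).1, (glue x.1 f).2 @: x.2)%SET)].

Record triangulation (N : nat) := Triangulation {
  glue : 'I_N -> 'I_4 -> 'I_N * 'S_4;
  glueK : forall j f,
    glue (glue j f).1 ((glue j f).2 f) = (j, ((glue j f).2)^-1%g);
  glue_free : forall j f, ((glue j f).1, (glue j f).2 f) <> (j, f);
  glue_orient : forall j f, odd_perm (glue j f).2;
  edge : 'I_N -> {set 'I_4} -> 'I_N;
  edgeP : forall j k (e e' : {set 'I_4}), #|e| = 2%N -> #|e'| = 2%N ->
    edge j e = edge k e' <-> connect (edge_glued glue) (j, e) (k, e');
  edge_surj : forall i, exists j, exists2 e : {set 'I_4},
    #|e| = 2%N & edge j e = i
}.

Section Combinatorics.
Variables (N : nat) (T : triangulation N).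

(* The pair of opposite edges carrying the label s:
   01 and 23 for z, 02 and 13 for z', 03 and 12 for z''. *)
Definition labelled (s : 'I_3) : {set {set 'I_4}} :=
  let e := [set v0; lift v0 s]%SET in [set e; ~: e]%SET.

Definition edge_count (s : 'I_3) (i j : 'I_N) : nat :=
  #|[set e in labelled s | edge T j e == i]%SET|.

(* The vertex link: the triangle (j, v) is cut off from tetrahedron j at its
   vertex v. Its corners and its sides are numbered by the vertices other than
   v: corner a lies on the edge {v, a} and side f on the face f. *)
Definition link_triangle := ('I_N * 'I_4)%type.

Definition across (t : link_triangle) (f : 'I_4) : link_triangle :=
  ((glue T t.1 f).1, (glue T t.1 f).2 t.2).

Definition link_adjacent : rel link_triangle :=
  fun t t' => [exists f, (f != t.2) && (across t f == t')].

Definition one_cusp := n_comp link_adjacent predT = 1%N.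

(* (j, p) is an oriented normal arc type in the triangle (j, p 0): it goes from
   the side p 2 to the side p 3, cutting off the corner p 1. *)
Definition arc_type := ('I_N * 'S_4)%type.

(* The next arc type when going round the corner p 1. *)
Definition turn (x : arc_type) : arc_type :=
  let g := glue T x.1 (x.2 v3) in (g.1, (tperm v2 v3 * x.2 * g.2)%g).

(* A path in the 1-skeleton of the cell structure dual to the link is given by
   its initial triangle and the word of the sides it crosses. Homotopy rel end
   points is generated by the insertion of backtracks and of loops running once
   around a vertex of the link, i.e. around a 2-cell of the dual structure. *)
Inductive link_homotopic (t : link_triangle) :
    seq 'I_4 -> seq 'I_4 -> Prop :=
  | LH_refl w : link_homotopic t w w
  | LH_sym w w' : link_homotopic t w w' -> link_homotopic t w' w
  | LH_trans w w' w'' : link_homotopic t w w' -> link_homotopic t w' w'' ->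
      link_homotopic t w w''
  | LH_backtrack w w' f : let t' := foldl across t w in f != t'.2 ->
      link_homotopic t (w ++ w') (w ++ [:: f; (glue T t'.1 f).2 f] ++ w')
  | LH_vertex w w' (x : arc_type) : (x.1, x.2 v0) = foldl across t w ->
      link_homotopic t (w ++ w')
        (w ++ [seq (y : arc_type).2 v3 | y <- fingraph.orbit turn x] ++ w').

Section Curves.
Variable R : realType.

(* A straight normal arc. Its end points are given by their relative distances
   from the corner p 1 which it cuts off. *)
Record arc := Arc {
  type_of : arc_type;
  entry_pos : R;
  exit_pos : R;
  entry_posP : 0 < entry_pos < 1;
  exit_posP : 0 < exit_pos < 1
}.

Definition tet_of (a : arc) : 'I_N := (type_of a).1.
Definition flag_of (a : arc) : 'S_4 := (type_of a).2.
Definition triangle_of (a : arc) : link_triangle := (tet_of a, flag_of a v0).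

(* Points of a link triangle in barycentric coordinates. *)
Definition entry_pt (a : arc) : 'rV[R]_4 :=
  (1 - entry_pos a) *: delta_mx 0 (flag_of a v1)
    + entry_pos a *: delta_mx 0 (flag_of a v3).

Definition exit_pt (a : arc) : 'rV[R]_4 :=
  (1 - exit_pos a) *: delta_mx 0 (flag_of a v1)
    + exit_pos a *: delta_mx 0 (flag_of a v2).

Definition arc_pt (a : arc) (r : R) : 'rV[R]_4 :=
  (1 - r) *: entry_pt a + r *: exit_pt a.

Definition continued_by (a b : arc) : Prop :=
  let f := flag_of a v3 in
  let s := (glue T (tet_of a) f).2 in
  [/\ triangle_of b = across (triangle_of a) f,
      flag_of b v2 = s f
    & col_perm s (entry_pt b) = exit_pt a].

(* A simple closed oriented peripheral curve in normal position, straightened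
   in each triangle of the link. *)
Record normal_curve := NormalCurve {
  nb_arcs : nat;
  arcs : 'I_nb_arcs.+1 -> arc;
  arcs_closed : forall i, continued_by (arcs i) (arcs (ordS i));
  arcs_simple : forall i k, i <> k ->
    triangle_of (arcs i) = triangle_of (arcs k) ->
    forall r r' : R, 0 <= r <= 1 -> 0 <= r' <= 1 ->
      arc_pt (arcs i) r <> arc_pt (arcs k) r'
}.

Arguments arcs : clear implicits.

Definition homotopically_trivial (th : normal_curve) : Prop :=
  link_homotopic (triangle_of (arcs th ord0))
    [seq flag_of (arcs th i) v3 | i : 'I_(nb_arcs th).+1] [::].

(* The count is +1 for a corner passed counterclockwise, as seen from the cusp:
   at the vertex 0, sent to oo, the corners 1, 2, 3 are at 0, 1, z, and going
   from the side [0,1] (number 3) to the side [0,z] (number 2) is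
   counterclockwise around 0, while (0,1,3,2) is an odd permutation. *)
Definition corner_count (th : normal_curve) (s : 'I_3) (j : 'I_N) : int :=
  \sum_(i | (tet_of (arcs th i) == j) &&
      ([set flag_of (arcs th i) v0; flag_of (arcs th i) v1]%SET
         \in labelled s))
    (if odd_perm (flag_of (arcs th i)) then 1 else -1).

End Curves.
End Combinatorics.

(* The principal branch of the logarithm. *)
Definition Carg (R : realType) (z : R[i]) : R :=
  let a := acos (complex.Re z / complex.Re `|z|) in
  if 0 <= complex.Im z then a else - a.

Definition Clog (R : realType) (z : R[i]) : R[i] :=
  Complex (ln (complex.Re `|z|)) (Carg z).

Section Shapes.
Variables (R : realType) (N : nat) (T : triangulation N).
Local Notation C := R[i].
Local Notation Cn := ('rV[C]_N : normedModType C).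

Definition shape (s : 'I_3) (z : C) : C :=
  match val s with
  | 0%N => z
  | 1%N => (1 - z)^-1
  | _ => 1 - z^-1
  end.

Definition gluing_map (z : 'rV[C]_N) : 'rV[C]_N :=
  \row_i \prod_j \prod_(s < 3) shape s (z 0 j) ^+ edge_count T s i j.

Definition positive_variety : set 'rV[C]_N :=
  [set z : 'rV[C]_N | (forall j, 0 < complex.Im (z 0 j)) /\ gluing_map z = const_mx 1].

Definition log_parameter (th : normal_curve T R) (z : 'rV[C]_N) : C :=
  \sum_j \sum_(s < 3) (corner_count th s j)%:~R * Clog (shape s (z 0 j)).

Definition complete_solution (th : normal_curve T R) (z : 'rV[C]_N) : Prop :=
  positive_variety z /\ log_parameter th z = 0.

(* [y], on the neighbourhood [U] of 0, is the inverse of the holomorphic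
   coordinate [log_parameter th] of the positive variety near [zs]. *)
Definition local_inverse (th : normal_curve T R) (zs : 'rV[C]_N)
    (U : set C^o) (y : C^o -> 'rV[C]_N) : Prop :=
  [/\ open_nbhs (0 : C^o) U,
      forall t, U t -> differentiable y t
    & exists W : set 'rV[C]_N,
      [/\ open_nbhs (zs : Cn) W,
          forall t, U t ->
            [/\ positive_variety (y t), W (y t) & log_parameter th (y t) = t]
        & forall z, positive_variety z -> W z ->
            U (log_parameter th z) /\ y (log_parameter th z) = z]].

Definition cusp_map (x : 'rV[C]_N) : C^o := \prod_i x 0 i ^+ 2.

Definition hat_matrix (th : normal_curve T R) (s : 'I_3) : 'M[C]_N :=
  \matrix_(i, j) if val i == N.-1 then (corner_count th s j)%:~R
                 else (edge_count T s i j)%:R.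

Definition zeta (s : 'I_3) (z : C) : C :=
  match val s with
  | 0%N => z^-1
  | 1%N => (1 - z)^-1
  | _ => (z * (z - 1))^-1
  end.

Definition zeta_diag (s : 'I_3) (z : 'rV[C]_N) : 'M[C]_N :=
  diag_mx (\row_j zeta s (z 0 j)).

End Shapes.

Section Torsion.
Variable K : fieldType.

Record cochain := Cochain {
  obj : nat -> vectType K;
  dmap : forall i, 'Hom(obj i, obj i.+1)
}.

Definition coboundaries (X : cochain) (i : nat) : {vspace obj X i} :=
  match i with
  | 0%N => 0%VS
  | i'.+1 => limg (dmap X i')
  end.

Definition acyclic (X : cochain) : Prop :=
  forall i, lker (dmap X i) = coboundaries X i.

(* The determinant [a : c]; it is meant for a and c of the same size. *)
Definition change_det (V : vectType K) (a c : seq V) : K :=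
  \det (\matrix_(i < size c, l < size c) coord (in_tuple c) l a`_i).

(* The torsion of an acyclic complex whose terms of degree >= n vanish, as the
   set of its values for all choices of bases b of the coboundaries and of
   lifts s of them, and for both signs. *)
Definition torsion (n : nat) (X : cochain) (c : forall i, seq (obj X i)) :
    set K :=
  [set t | exists b s : forall i, seq (obj X i),
    [/\ forall i, basis_of (coboundaries X i) (b i),
        forall i, map (dmap X i) (s i) = b i.+1
      & let P := \prod_(i < n)
          change_det (b i ++ s i) (c i) ^ ((-1) ^+ i : int) in
        t = P \/ t = - P]].

End Torsion.

Arguments torsion {K} n X c.

Definition pm (K : zmodType) (x : K) : set K := [set t | t = x \/ t = - x].

Section GluingComplex.
Variables (R : realType) (N : nat) (T : triangulation N).
Local Notation C := R[i].
Local Notation Cn := ('rV[C]_N : normedModType C).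

Definition gluing_obj (i : nat) : vectType C :=
  match i with
  | 0%N | 3%N => C^o
  | 1%N | 2%N => 'rV[C]_N
  | _ => 'rV[C]_0
  end.

Definition gluing_diff (y : C^o -> 'rV[C]_N) (t : C^o) (i : nat) :
    'Hom(gluing_obj i, gluing_obj i.+1) :=
  match i return 'Hom(gluing_obj i, gluing_obj i.+1) with
  | 0%N => linfun ('d y t)
  | 1%N => linfun ('d (gluing_map T : Cn -> Cn) (y t : Cn))
  | 2%N => linfun ('d (@cusp_map R N : Cn -> C^o) (const_mx 1 : Cn))
  | _ => 0
  end.

Definition gluing_complex (y : C^o -> 'rV[C]_N) (t : C^o) : cochain C :=
  Cochain (gluing_diff y t).

Definition gluing_basis (i : nat) : seq (gluing_obj i) :=
  match i return seq (gluing_obj i) with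
  | 0%N | 3%N => [:: 1 : C^o]
  | 1%N | 2%N => [seq (delta_mx 0 j : 'rV[C]_N) | j : 'I_N]
  | _ => [::]
  end.

End GluingComplex.

(* Main.v *)
(* Since g(z) = 1, the matrix of Dg at z = y(u) is the Jacobian M of log g, and
   the derivative h of y satisfies M h = 0 and Du h = 1. The columns of M sum to
   zero, which is Dp Dg = 0, so that exactness amounts to rank M >= N - 1.

   Rank. Over the reals the edge rows span an isotropic subspace S of dimension
   N - 1 of the symplectic space of the log-shapes: isotropy holds because gluing
   maps reverse the orientation of faces, and the only relation between the rows
   is their sum because the vertex link is connected. The tangent plane L to the
   shape space is Lagrangian, and the Hermitian form of the symplectic structure
   is definite on it as Im z > 0. Hence ker M, its conjugate and S are independent
   in the orthogonal of S, which has dimension N + 1, and dim (ker M) <= 1.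

   Torsion. Let Mhat be M with its last row replaced by Du, and let a, s_i, w be
   the lifts in degrees 0, 1, 2. The matrix Mhat takes the frame (a h, s_1, ...,
   s_(N-1)) to one whose determinant is, up to sign, a times the minor of the
   M s_i without last coordinate. Adding all coordinates to the last one in the
   frame (M s_1, ..., M s_(N-1), w) gives the same minor times the sum of the
   coordinates of w, which is half of Dp w. *)
From HB Require Import structures.
Require Import Defs.
From mathcomp Require Import all_boot all_order all_fingroup all_algebra.
From mathcomp Require Import complex ring zify.
From mathcomp Require Import all_classical all_reals all_analysis.
Import Order.TTheory GRing.Theory Num.Theory.
Import numFieldNormedType.Exports.
Local Open Scope classical_set_scope.
Local Open Scope ring_scope.
Set Implicit Arguments.
Unset Strict Implicit.
Unset Printing Implicit Defensive.

Local Notation glue := Defs.glue.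
Local Notation edge := Defs.edge.
Local Notation shape := Defs.shape.

(** * Relations between edge rows *)

Section EdgeRelations.
Variables (N : nat) (T : triangulation N).

Lemma flag_exists (a b v w : 'I_4) : a != b -> v != w ->
  exists p : 'S_4, p a = v /\ p b = w.
Proof.
move=> ab vw; have [q qa] : exists q : 'S_4, q a = v.
  by exists (tperm a v); rewrite tpermL.
exists (q * tperm (q b) w)%g; rewrite !permM tpermL qa; split=> //.
by rewrite tpermD // 1?eq_sym // -qa (inj_eq perm_inj).
Qed.

(** The edge from [p a] to [p b] lies in the face opposite to [p v3], so one elementary gluing
    identifies it with its image. *)
Lemma edge_across j (p : 'S_4) (a b : 'I_4) : a != b -> a != v3 -> b != v3 ->
  let g := glue T j (p v3) in
  edge T g.1 [set (p * g.2)%g a; (p * g.2)%g b]%SET = edge T j [set p a; p b]%SET.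
Proof.
move=> ab a3 b3 /=; set g := glue T j _.
have pab : p a != p b by rewrite (inj_eq perm_inj).
have gpab : g.2 (p a) != g.2 (p b) by rewrite (inj_eq perm_inj).
apply/esym/edgeP; rewrite ?cards2 ?permM ?pab ?gpab //; apply: connect1.
apply/existsP; exists (p v3); rewrite /= !inE !(inj_eq perm_inj).
rewrite ![v3 == _]eq_sym (negPf a3) (negPf b3) /=.
by apply/eqP; congr (_, _); rewrite imsetU1 imset_set1.
Qed.

Lemma sum_labelled (V : zmodType) s (F : {set 'I_4} -> V) :
  \sum_(e in labelled s) F e
  = F [set v0; lift v0 s]%SET + F (~: [set v0; lift v0 s])%SET.
Proof.
rewrite big_setU1 ?big_set1 //= inE; apply/negP => /eqP/setP/(_ v0).
by rewrite !inE eqxx.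
Qed.

Lemma setC_flag (p : 'S_4) (a b c d : 'I_4) : uniq [:: a; b; c; d] ->
  (~: [set p a; p b] = [set p c; p d])%SET.
Proof.
move=> u; apply/setP=> x; rewrite !inE -(permKV p x) !(inj_eq perm_inj).
have : p^-1%g x \in [:: a; b; c; d].
  have [||_ ->] := uniq_min_size u (s2 := enum 'I_4); last by rewrite mem_enum.
  - by move=> ?; rewrite mem_enum.
  - by rewrite -cardE card_ord.
move: u; rewrite /= !inE !negb_or -!andbA.
have neqF (y z : 'I_4) : y != z -> ((y == z) = false) * ((z == y) = false).
  by move=> yz; rewrite (negPf yz) eq_sym (negPf yz).
by case/and4P=> /neqF ab /neqF ac /neqF ad /and4P [/neqF bc /neqF bd /neqF cd _]
  /or4P[]/eqP->; rewrite ?eqxx ?ab ?ac ?ad ?bc ?bd ?cd.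
Qed.

(** Crossing a side is undone by [glueK], so adjacency is symmetric and components are classes with
    a common root; one cusp leaves one root. *)
Lemma link_connected_const (V : zmodType) (a : link_triangle N -> V) : one_cusp T ->
    (forall t f, f != t.2 -> a (across T t f) = a t) ->
  forall t t', a t = a t'.
Proof.
move=> cusp aE.
have adjW t t' : link_adjacent T t t' -> link_adjacent T t' t.
  case: t t' => [j v] [k w] /existsP [f] /= /andP[fv /eqP].
  rewrite /across /= => -[<- <-]; apply/existsP; exists ((glue T j f).2 f).
  by rewrite (inj_eq perm_inj) fv /across /= glueK /= permK eqxx.
have adjC : symmetric (link_adjacent T) by move=> x y; apply/idP/idP; apply: adjW.
have cC := sym_connect_sym adjC.
have const x y : connect (link_adjacent T) x y -> a x = a y.
  case/connectP => p + ->; elim: p x => //= z p IH x /andP[/existsP[f]].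
  by case/andP => fx /eqP <- /IH <-; rewrite aE.
move=> t t'; apply: const.
have /eqP/card1P [x xE] := cusp.
have root_x z : fingraph.root (link_adjacent T) z = x.
  by apply/eqP; move: (xE (fingraph.root (link_adjacent T) z)); rewrite !inE (roots_root cC).
by rewrite -(root_connect cC) !root_x.
Qed.

(** The labels name a pair of opposite edges by its member through vertex 0, and every edge or its
    complement contains that vertex. *)
Lemma opposite_sum (V : zmodType) j (c : 'I_N -> V) (A : V) :
    (forall s, \sum_(e in labelled s) c (edge T j e) = A) ->
  forall v w : 'I_4, v != w ->
    c (edge T j [set v; w]%SET) + c (edge T j (~: [set v; w])%SET) = A.
Proof.
move=> cA.
have c0 w : w != v0 ->
    c (edge T j [set v0; w]%SET) + c (edge T j (~: [set v0; w])%SET) = A.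
  case: (unliftP v0 w) => [s -> _|->]; last by rewrite eqxx.
  by rewrite -(cA s) sum_labelled.
move=> v w vw; have [p [<- <-]] := flag_exists (isT : v0 != v1) vw.
have pI (a b : 'I_4) : a != b -> p a != p b by rewrite (inj_eq perm_inj).
have {c0} cE (x y : 'I_4) : x != y -> v0 \in [set x; y]%SET ->
    c (edge T j [set x; y]%SET) + c (edge T j (~: [set x; y])%SET) = A.
  move=> xy; rewrite !inE => /orP[]/eqP e; move: xy; rewrite -e => xy.
    by rewrite c0 // eq_sym.
  by rewrite finset.setUC c0.
have [v0E|v0E] := boolP (v0 \in [set p v0; p v1]%SET); first by rewrite cE ?pI.
rewrite -finset.in_setC (@setC_flag p v0 v1 v2 v3) // in v0E.
rewrite (@setC_flag p v0 v1 v2 v3) // addrC -(@setC_flag p v2 v3 v0 v1) //.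
by rewrite cE ?pI.
Qed.

Lemma sum_flag (V : zmodType) (p : 'S_4) (F : 'I_4 -> V) :
  \sum_i F i = F (p v0) + F (p v1) + F (p v2) + F (p v3).
Proof.
rewrite (reindex_inj (@perm_inj _ p)) !big_ord_recl big_ord0 /= addr0 !addrA.
by do 3?congr (_ + _); congr (F (fun_of_perm p _)); apply: val_inj.
Qed.

(* The relation makes c(vw) + c(vx) - c(wx) depend only on the vertex v of the
   tetrahedron, not on the face vwx; being computed in a face, this number is
   the same in the neighbouring tetrahedron, so it is a function on the
   connected link, and c(vw) is half the sum of its values at v and w. *)
Lemma edge_relation_const (K : numFieldType) (c : 'I_N -> K) (A : 'I_N -> K) :
    one_cusp T ->
    (forall j s, \sum_(e in labelled s) c (edge T j e) = A j) ->
  forall i k, c i = c k.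
Proof.
move=> cusp cA.
pose E j (p : 'S_4) a b := c (edge T j [set p a; p b]%SET).
have opp j p a b d e : uniq [:: a; b; d; e] -> E j p a b + E j p d e = A j.
  move=> u; rewrite /E -(setC_flag p u); apply: opposite_sum => //.
  by rewrite (inj_eq perm_inj); move: u; rewrite /= inE => /andP[/norP[]].
(* Subtracting [A] trades the third edge at the vertex for minus its opposite, leaving the three
   edges of one face, whichever face at the vertex is chosen. *)
pose a (t : link_triangle N) :=
  \sum_(w | w != t.2) c (edge T t.1 [set t.2; w]%SET) - A t.1.
have aE j (p : 'S_4) : a (j, p v0) = E j p v0 v1 + E j p v0 v2 - E j p v1 v2.
  rewrite /a /= big_mkcond (sum_flag p) /= !(inj_eq perm_inj) /= add0r.
  by rewrite -(opp j p v0 v3 v1 v2) // /E; ring.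
have aE' j (p : 'S_4) : a (j, p v0) + a (j, p v1) = E j p v0 v1 *+ 2.
  have := aE j (tperm v0 v1 * p)%g; rewrite /E !permM tpermL tpermR tpermD //.
  by rewrite aE => ->; rewrite [in c (edge T j [set p v1; p v0]%SET)]finset.setUC /E; ring.
have a_const : forall t t', a t = a t'.
  apply: link_connected_const => // -[j v] f /= fv.
  have [p [p3 p0]] := @flag_exists v3 v0 f v isT fv.
  rewrite /across /= -p0 -p3; set g := glue T j _; rewrite aE -permM aE /E /=.
  by rewrite !edge_across.
have c2 i : c i *+ 2 = a (i, v0) *+ 2.
  have [j [e /eqP/cards2P [x [y [xy ->]]] <-]] := edge_surj T i.
  have [p [px py]] := flag_exists (isT : v0 != v1) xy.
  have := aE' j p; rewrite /E px py => <-.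
  by rewrite !(a_const _ (edge T j [set x; y]%SET, v0)) mulr2n.
move=> i k; have : c i *+ 2 = c k *+ 2 by rewrite !c2 (a_const _ (k, v0)).
by move=> /eqP; rewrite -subr_eq0 -mulrnBl mulrn_eq0 subr_eq0 => /eqP.
Qed.
End EdgeRelations.

(** * Isotropy of the edge rows *)

(** A permutation amounts to the image of the first element and a permutation of the rest;
    [lift_perm] is injective on such pairs, and (n+1) n! = (n+1)! makes it bijective. *)
Lemma sum_lift_perm (V : nmodType) n (F : 'S_n.+1 -> V) :
  \sum_p F p = \sum_j \sum_(q : 'S_n) F (lift_perm ord0 j q).
Proof.
rewrite pair_bigA /=; apply: (reindex (fun x => lift_perm ord0 x.1 x.2)).
apply/onW_bij/inj_card_bij; last first.
  by rewrite card_prod card_ord !card_Sn factS.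
move=> [j q] [k r] /= E.
have jk : j = k by rewrite -(lift_perm_id ord0 j q) E lift_perm_id.
congr (_, _) => //; apply/permP=> i; apply: (@lift_inj _ j).
by rewrite -(lift_perm_lift ord0 j q) E jk lift_perm_lift.
Qed.

(** Expanding three times by the image of the first element leaves 24 explicit terms, signed by the
    parity of the chosen positions. *)
Lemma sum_sign_flag (K : comNzRingType) (G : 'I_4 -> 'I_4 -> 'I_4 -> K) :
  \sum_(p : 'S_4) (-1) ^+ p * G (p v0) (p v1) (p v2)
  = \sum_(a < 4) \sum_(b < 3) \sum_(c < 2)
      (-1) ^+ (a + b + c) * G a (lift a b) (lift a (lift b c)).
Proof.
have S1 (F : 'S_1 -> K) : \sum_q F q = F 1%g.
  by apply: big_pred1 => q /=; apply/esym/eqP/permP=> i; rewrite !ord1.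
have e0 : v0 = ord0 by apply: val_inj.
have e1 : v1 = lift ord0 ord0 by apply: val_inj.
have e2 : v2 = lift ord0 (lift ord0 ord0) by apply: val_inj.
rewrite sum_lift_perm; apply: eq_bigr => a _.
rewrite sum_lift_perm; apply: eq_bigr => b _.
rewrite sum_lift_perm; apply: eq_bigr => c _.
rewrite S1 e0 e1 e2 !(lift_perm_id, lift_perm_lift) !odd_lift_perm odd_perm1 /=.
by rewrite addbF addbA -!oddD signr_odd.
Qed.

(** The signed sum over pairs of edges meeting at a vertex is the Neumann-Zagier symplectic form of
    the label sums, written in their differences with the third label. *)
Lemma sum_sign_pairs (K : comNzRingType) (f g : {set 'I_4} -> K) :
  let x s := \sum_(e in labelled s) f e in
  let y s := \sum_(e in labelled s) g e in
  \sum_(p : 'S_4) (-1) ^+ p * (f [set p v0; p v1]%SET * g [set p v0; p v2]%SET)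
  = (x sz - x sz'') * (y sz' - y sz'') - (x sz' - x sz'') * (y sz - y sz'').
Proof.
move=> x y; rewrite (sum_sign_flag (fun a b c => f [set a; b]%SET * g [set a; c]%SET)).
pose r (h : {set 'I_4} -> K) a b := h [set inord a; inord b]%SET.
have rE h (a b : 'I_4) : h [set a; b]%SET = r h a b by rewrite /r !inord_val.
have rC h a b : r h a b = r h b a by rewrite /r finset.setUC.
have labE h s : \sum_(e in labelled s) h e =
    r h 0 (bump 0 s) + h (~: [set v0; lift v0 s])%SET.
  by rewrite sum_labelled rE.
have C s (a b : 'I_4) : uniq [:: v0; lift v0 s; a; b] ->
   (~: [set v0; lift v0 s] = [set a; b])%SET.
  by move=> /(setC_flag 1%g); rewrite !perm1.
rewrite /x /y !labE !(@C sz v2 v3) // !(@C sz' v1 v3) // !(@C sz'' v1 v2) //.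
under eq_bigr do under eq_bigr do under eq_bigr do rewrite !rE.
rewrite !rE !big_ord_recl !big_ord0 /bump /=.
rewrite ![r _ 1 0]rC ![r _ 2 0]rC ![r _ 3 0]rC ![r _ 2 1]rC ![r _ 3 1]rC ![r _ 3 2]rC.
ring.
Qed.

Section Isotropy.
Variables (N : nat) (T : triangulation N) (K : numFieldType).

Lemma edge_countE s i j :
  (edge_count T s i j)%:R = \sum_(e in labelled s) (edge T j e == i)%:R :> K.
Proof.
rewrite /edge_count -sum1_card natr_sum [RHS]big_mkcond [LHS]big_mkcond /=.
by apply: eq_bigr => e _; rewrite inE; case: (e \in _); case: (_ == i).
Qed.

(* Two edges sharing a vertex lie in exactly one face, hence the sum is one over
   the faces; the gluing involution reverses their orientations. *)
Lemma flag_sum_opp (u v : 'I_N -> K) :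
  let S := \sum_j \sum_(p : 'S_4) (-1) ^+ p *
      (u (edge T j [set p v0; p v1]%SET) * v (edge T j [set p v0; p v2]%SET)) in
  S = - S.
Proof.
pose h (x : 'I_N * 'S_4) :=
  let g := glue T x.1 (x.2 v3) in (g.1, (x.2 * g.2)%g).
have hK : involutive h.
  by move=> [j p]; rewrite /h /= permM glueK /= mulgK.
rewrite /= !pair_bigA /= {1}(reindex_inj (inv_inj hK)) -sumrN.
apply: eq_bigr => -[j p] _; rewrite !(@edge_across _ T j p) //.
by rewrite odd_permM glue_orient addbT signrN mulNr.
Qed.

(** For the indicators of two edge classes the flag sum is this form, and a number equal to its
    opposite vanishes in characteristic zero. *)
Lemma edge_rows_isotropic i k :
  let x s j : K := (edge_count T s i j)%:R in
  let y s j : K := (edge_count T s k j)%:R in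
  \sum_j ((x sz j - x sz'' j) * (y sz' j - y sz'' j)
          - (x sz' j - x sz'' j) * (y sz j - y sz'' j)) = 0.
Proof.
move=> x y; have := flag_sum_opp (fun e => (e == i)%:R) (fun e => (e == k)%:R).
move=> /= /eqP; rewrite -subr_eq0 opprK -mulr2n mulrn_eq0 /= => /eqP S0.
rewrite -[RHS]S0; apply: eq_bigr => j _; rewrite /x /y !edge_countE.
by rewrite (sum_sign_pairs (fun e => (edge T j e == i)%:R) (fun e => (edge T j e == k)%:R)).
Qed.

End Isotropy.

(** * Positive Lagrangian planes *)

(** The hypothesis confines the left kernel to the line of constant rows. *)
Lemma rank_ker_const (F : fieldType) m n (B : 'M[F]_(m, n)) :
    (forall c : 'rV_m, c *m B = 0 -> forall i k, c 0 i = c 0 k) ->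
  (m <= (\rank B).+1)%N.
Proof.
move=> Bconst; have := mxrank_ker B; case: m B Bconst => [//|m] B Bconst kerB.
suff : (\rank (kermx B) <= 1)%N by rewrite kerB leq_subLR addn1.
suff /mxrankS/leq_trans : (kermx B <= (const_mx 1 : 'rV[F]_m.+1))%MS.
  by apply; apply: rank_leq_row.
apply/row_subP => i; have /Bconst c_const : row i (kermx B) *m B = 0.
  by apply/sub_kermxP; apply: row_sub.
suff -> : row i (kermx B) = row i (kermx B) 0 0 *: const_mx 1 by apply: scalemx_sub.
by apply/rowP => j; rewrite [RHS]mxE [X in _ * X]mxE mulr1; apply: c_const.
Qed.

Section Lagrangian.
Variables (C : numClosedFieldType) (m n : nat).
Variables (G1 G2 : 'M[C]_(m, n)) (p q : 'rV[C]_n).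
Local Notation conjm := (map_mx (@Num.conj C)).
Hypotheses (G1r : conjm G1 = G1) (G2r : conjm G2 = G2).
Hypothesis isotropic : G1 *m G2^T = G2 *m G1^T.
Hypothesis positive :
  forall j, 0 < 'i * (p 0 j * (q 0 j)^* - q 0 j * (p 0 j)^*).

(** The rows of [A] span a real isotropic subspace, those of [P] a complex Lagrangian plane; [J] is
    the matrix of the symplectic form. *)
Let A := row_mx G1 G2.
Let P := row_mx (diag_mx p) (diag_mx q).
Let J : 'M[C]_(n + n) := block_mx 0 (- 1%:M) 1%:M 0.

Let mulJ k (X Y : 'M[C]_(k, n)) : row_mx X Y *m J = row_mx Y (- X).
Proof. by rewrite mul_row_block !mulmx0 !mulmx1 mulmxN mulmx1 add0r addr0. Qed.

Let JJ : J *m J = - 1%:M.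
Proof.
rewrite mulmx_block !mulmx0 !mul0mx mulNmx mulmxN !mulmx1 !add0r !addr0.
by rewrite [in RHS]scalar_mx_block opp_block_mx !oppr0.
Qed.

Let Ar : conjm A = A.
Proof. by rewrite map_row_mx G1r G2r. Qed.

Let AJA : A *m J *m A^T = 0.
Proof. by rewrite mulJ tr_row_mx mul_row_col mulNmx isotropic subrr. Qed.

Let pair_formE k l (X Y : 'M[C]_(k, n)) (Z W : 'M[C]_(l, n)) :
  row_mx X Y *m J *m (row_mx Z W)^T = Y *m Z^T - X *m W^T.
Proof. by rewrite mulJ tr_row_mx mul_row_col mulNmx. Qed.

Let conjP : conjm P = row_mx (diag_mx (conjm p)) (diag_mx (conjm q)).
Proof. by rewrite map_row_mx !map_diag_mx. Qed.

(** Pair the relation, through [J], with the conjugate of a P. The term in [b] vanishes because the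
    conjugate of [P] is Lagrangian, the right side because [A] is real and a P A^T = 0; what remains
    is a positive combination of the |a_j|^2. *)
Let positive_part (a b : 'rV_n) (c : 'rV_m) :
    a *m P *m A^T = 0 -> a *m P + b *m conjm P = c *m (A *m J) -> a = 0.
Proof.
move=> aP0 E; pose w := conjm a *m conjm P.
have wA : A *m w^T = 0.
  apply: trmx_inj; rewrite trmx_mul trmxK trmx0 /w -Ar map_trmx -!map_mxM.
  by rewrite aP0 map_mx0.
have /matrixP/(_ 0 0) : (a *m P + b *m conjm P) *m J *m w^T = 0.
  by rewrite E -!mulmxA (mulmxA J J) JJ mulNmx mul1mx !mulmxN wA mulmx0 oppr0.
rewrite !mulmxDl /w conjP !mul_mx_row !pair_formE !mul_mx_diag !mxE.
rewrite -!sumrB -big_split /=.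
under eq_bigr do rewrite !mxE.
pose d j := 'i * (p 0 j * (q 0 j)^* - q 0 j * (p 0 j)^*).
rewrite (eq_bigr (fun j => 'i * (d j * (a 0 j * (a 0 j)^*)))); last first.
  move=> j _; rewrite /d; have := sqrCi C; rewrite expr2; move: 'i => ii iiE.
  by rewrite !mulrA iiE; ring.
rewrite -mulr_sumr => /eqP; rewrite mulf_eq0 (negPf (neq0Ci C)) /= psumr_eq0 => [/allP a0|j _].
  apply/rowP => j; have := a0 j (mem_index_enum _); rewrite mulf_eq0.
  by rewrite (gt_eqF (positive j)) -normCK sqrf_eq0 normr_eq0 => /eqP->; rewrite mxE.
by rewrite mulr_ge0 ?(ltW (positive j)) // -normCK exprn_ge0.
Qed.

(* With K the space of all a such that a P A^T = 0, the space K P, its conjugate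
   and the row space of A J are independent in the orthogonal of A, because the
   Hermitian form x J (conj y)^T is definite on K P. *)
Lemma mxrank_lagrangian :
  (\rank A <= \rank (G1 *m diag_mx p + G2 *m diag_mx q)%R)%N.
Proof.
set M := (_ + _)%R; have ME : M = A *m P^T.
  by rewrite tr_row_mx mul_row_col !tr_diag_mx.
have P_free : row_free P.
  have d0 j : p 0 j != 0.
    apply: contraTneq (positive j) => p0; rewrite p0 conjC0 mul0r mulr0 subr0 mulr0.
    by rewrite ltxx.
  apply/row_freeP; exists (col_mx (diag_mx (\row_j (p 0 j)^-1)) 0).
  rewrite mul_row_col mulmx0 addr0 mulmx_diag -diag_const_mx; congr diag_mx.
  by apply/rowP => j; rewrite !mxE divff.
have J_free : row_free J.
  by apply/row_freeP; exists (- J); rewrite mulmxN JJ opprK.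
(* As [M] is the transpose of P A^T, the kernel [K] has dimension n - rank M. *)
pose K := kermx (P *m A^T); pose X := K *m P; pose Y := conjm X.
have rK : \rank K = (n - \rank M)%N.
  by rewrite mxrank_ker -mxrank_tr trmx_mul trmxK ME.
have rX : \rank X = \rank K by apply: mxrankMfree.
have rY : \rank Y = \rank K by rewrite mxrank_map.
have XA : X *m A^T = 0 by rewrite -mulmxA; apply: mulmx_ker.
have YA : Y *m A^T = 0 by rewrite -Ar map_trmx -map_mxM XA map_mx0.
have split0 (x y : 'rV_(n + n)) : (x <= X)%MS -> (y <= Y)%MS ->
    ((x + y)%R <= A *m J)%MS -> x = 0 /\ y = 0.
  move=> /submxP[a ->] /submxP[b ->] /submxP[c].
  rewrite /Y /X map_mxM (mulmxA a) (mulmxA b) => E.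
  have KP k (d : 'M[C]_(k, n)) : d *m K *m P *m A^T = 0.
    by rewrite -(mulmxA d) -mulmxA XA mulmx0.
  have a0 : a *m K = 0 by apply: positive_part (KP _ a) E.
  have conjmK k l (Z : 'M[C]_(k, l)) : conjm (conjm Z) = Z.
    by apply/matrixP => r s; rewrite !mxE conjCK.
  have Jr : conjm J = J.
    by rewrite map_block_mx map_mxN map_scalar_mx rmorph1 !map_mx0.
  (* Conjugation exchanges the two summands, so the same positivity applies to [b]. *)
  have b0 : conjm b *m K = 0.
    apply: (positive_part (b := conjm (a *m K)) (c := conjm c)) => //.
    have := congr1 conjm E; rewrite map_mxD [RHS]map_mxM (map_mxM _ A) Ar Jr => <-.
    by rewrite addrC !map_mxM !conjmK.
  split; first by rewrite a0 mul0mx.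
  by rewrite -(conjmK _ _ b) -map_mxM b0 map_mx0 mul0mx.
have XY0 : (X :&: Y)%MS = 0.
  apply/eqP/rowV0P => v; rewrite sub_capmx => /andP[vX vY].
  have [||//] := split0 v (- v) vX; first by rewrite eqmx_opp.
  by rewrite subrr sub0mx.
have XYA0 : ((X + Y) :&: (A *m J))%MS = 0.
  apply/eqP/rowV0P => v; rewrite sub_capmx => /andP[/sub_addsmxP[[x y] /= ->] vA].
  by have [-> ->] := split0 _ _ (submxMl x X) (submxMl y Y) vA; rewrite addr0.
(* The three spaces lie in an orthogonal of dimension 2n - rank A, so 2 (n - rank M) + rank A <= 2n
   - rank A. *)
have /mxrankS : (X + Y + A *m J <= kermx A^T)%MS.
  by rewrite !addsmx_sub -andbA; apply/and3P; split; apply/sub_kermxP.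
rewrite !mxrank_disjoint_sum // rX rY rK mxrank_ker mxrank_tr (mxrankMfree A) //.
have := rank_leq_col M; have := rank_leq_col A.
lia.
Qed.

End Lagrangian.

(** * Rank of the gluing Jacobian *)

Lemma complex_Im_gt0 (R : realType) (z : R[i]) : (0 < complex.Im z) = (0 < 'Im z).
Proof. by rewrite -complexIm ltcR. Qed.

Section LogJacobian.
Variables (R : realType) (N : nat) (T : triangulation N).
Local Notation C := R[i].

Definition gluing_matrix s : 'M[C]_N := \matrix_(i, j) (edge_count T s i j)%:R.

(** [zeta s] is the logarithmic derivative of [shape s], so these are the partial derivatives of log
    g. *)
Definition log_jacobian (z : 'rV[C]_N) : 'M[C]_N :=
  gluing_matrix sz *m zeta_diag sz z + gluing_matrix sz' *m zeta_diag sz' z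
  + gluing_matrix sz'' *m zeta_diag sz'' z.

Lemma mul_gluing_matrix (c : 'rV[C]_N) s j :
  (c *m gluing_matrix s) 0 j = \sum_(e in labelled s) c 0 (edge T j e).
Proof.
rewrite mxE; under eq_bigr do rewrite mxE edge_countE mulr_sumr.
rewrite exchange_big /=; apply: eq_bigr => e _.
rewrite (bigD1 (edge T j e)) //= eqxx mulr1 big1 ?addr0 // => i.
by rewrite eq_sym => /negPf->; rewrite mulr0.
Qed.

Lemma shape_neq0 (z : C) : 0 < complex.Im z -> (z != 0) * (1 - z != 0).
Proof.
case: z => x y /= y0; split; rewrite eq_complex /= negb_and.
  by rewrite (gt_eqF y0) orbT.
by rewrite sub0r oppr_eq0 (gt_eqF y0) orbT.
Qed.

(** The product of the three shapes is -1, so their logarithmic derivatives cancel. *)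
Lemma sum_zeta (z : C) : 0 < complex.Im z -> zeta sz z + zeta sz' z + zeta sz'' z = 0.
Proof.
move=> /shape_neq0 [z0 z1]; rewrite /zeta /=.
have z1' : z - 1 != 0 by rewrite -opprB oppr_eq0.
by field; rewrite z0 z1 z1'.
Qed.

(** Each label sits on two edges of every tetrahedron, so all columns of the gluing matrices sum to
    2; then [sum_zeta] applies. *)
Lemma const_mul_log_jacobian (z : 'rV[C]_N) : (forall j, 0 < complex.Im (z 0 j)) ->
  (const_mx 1 : 'rV_N) *m log_jacobian z = 0.
Proof.
move=> z_gt0.
have sum2 s : (const_mx 1 : 'rV_N) *m gluing_matrix s = const_mx 2%:R.
  by apply/rowP => j; rewrite mul_gluing_matrix sum_labelled !mxE -mulr2n.
rewrite !mulmxDr !mulmxA !sum2 !mul_mx_diag.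
by apply/rowP => j; rewrite !mxE -!mulrDr sum_zeta // mulr0.
Qed.

Lemma rank_log_jacobian (z : 'rV[C]_N) : one_cusp T ->
  (forall j, 0 < complex.Im (z 0 j)) -> (N <= (\rank (log_jacobian z)).+1)%N.
Proof.
move=> cusp z_gt0.
pose G1 := gluing_matrix sz - gluing_matrix sz''.
pose G2 := gluing_matrix sz' - gluing_matrix sz''.
have -> : log_jacobian z = G1 *m zeta_diag sz z + G2 *m zeta_diag sz' z.
  have -> : log_jacobian z = G1 *m zeta_diag sz z + G2 *m zeta_diag sz' z
     + gluing_matrix sz'' *m (zeta_diag sz z + zeta_diag sz' z + zeta_diag sz'' z).
    rewrite !mulmxBl !mulmxDr /log_jacobian !addrA; congr (_ + _).
    by rewrite [RHS]addrAC subrK addrAC subrK.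
  suff -> : zeta_diag sz z + zeta_diag sz' z + zeta_diag sz'' z = 0.
    by rewrite mulmx0 addr0.
  by apply/matrixP => i j; rewrite !mxE -!mulrnDl sum_zeta // mul0rn.
have real_gluing s : map_mx Num.conj (gluing_matrix s) = gluing_matrix s.
  by apply/matrixP => i j; rewrite !mxE conjC_nat.
apply: leq_trans (_ : (\rank (row_mx G1 G2)).+1 <= _)%N; last first.
  rewrite ltnS; apply: mxrank_lagrangian.
  - by rewrite map_mxB !real_gluing.
  - by rewrite map_mxB !real_gluing.
  - apply/matrixP => i k; have := edge_rows_isotropic T C i k.
    move=> /= /eqP; rewrite sumrB subr_eq0 => /eqP; rewrite !mxE => E.
    under eq_bigr do rewrite !mxE; rewrite E.
    by apply: eq_bigr => j _; rewrite !mxE.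
  - move=> j; rewrite !mxE /zeta /=; have [z0 z1] := shape_neq0 (z_gt0 j).
    move: (z_gt0 j); rewrite complex_Im_gt0; move: (z 0 j) z0 z1 => w w0 w1 Im_w.
    have wc0 : w^* != 0 by rewrite conjC_eq0.
    have wc1 : 1 - w^* != 0 by rewrite -(rmorph1 Num.conj) -rmorphB conjC_eq0.
    have -> : 'i * (w^-1 * ((1 - w)^-1)^* - (1 - w)^-1 * (w^-1)^*)
       = 2 * 'Im w * (`|w| ^- 2 * `|1 - w| ^- 2).
      rewrite !fmorphV rmorphB rmorph1 /= !normCK rmorphB rmorph1 /= ImE.
      by field; rewrite w0 w1 wc0 wc1.
    by rewrite !mulr_gt0 ?invr_gt0 ?exprn_gt0 ?normr_gt0.
(* A relation [c] between the rows says that the sums of [c] over the pairs of opposite edges agree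
   for the three labels. *)
apply: rank_ker_const => c /eqP.
rewrite mul_mx_row row_mx_eq0 !mulmxBr !subr_eq0 => /andP[/eqP c0 /eqP c1].
pose A j := \sum_(e in labelled sz) c 0 (edge T j e).
apply: (edge_relation_const (A := A) cusp) => j s.
have sumE s' : \sum_(e in labelled s') c 0 (edge T j e) = (c *m gluing_matrix s') 0 j.
  by rewrite mul_gluing_matrix.
rewrite /A !sumE; congr (fun_of_matrix _ 0 j).
case: s => -[|[|[|//]]] lt_s3.
- by congr (_ *m gluing_matrix _); apply: val_inj.
- by rewrite c0 -c1; congr (_ *m gluing_matrix _); apply: val_inj.
- by rewrite c0; congr (_ *m gluing_matrix _); apply: val_inj.
Qed.

End LogJacobian.

(** * Differentials of the gluing and cusp maps *)

Section LogDifferential.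
Variables (K : numFieldType) (V : normedModType K).
Implicit Types (f g L : V -> K) (x : V).

Lemma is_diff_sum (W : normedModType K) (I : Type) (r : seq I)
    (F dF : I -> V -> W) x :
  (forall i, is_diff x (F i) (dF i)) ->
  is_diff x (fun v => \sum_(i <- r) F i v) (fun v => \sum_(i <- r) dF i v).
Proof.
move=> FdF; elim: r => [|i r IH].
  rewrite [X in is_diff _ X _](_ : _ = cst 0); last by apply/funext => v; rewrite big_nil.
  by apply: is_diff_eq; apply/funext => v; rewrite big_nil.
rewrite [X in is_diff _ X _](_ : _ = F i + fun v => \sum_(i <- r) F i v); last first.
  by apply/funext => v; rewrite big_cons.
by apply: is_diff_eq; apply/funext => v; rewrite big_cons.
Qed.

Lemma is_diff_row n (f df : V -> 'rV[K]_n) x :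
  (forall i, is_diff x (fun v => f v 0 i) (fun v => df v 0 i)) ->
  is_diff x f df.
Proof.
move=> fdf.
have rowE (h : V -> 'rV[K]_n) : h = fun v => \sum_i h v 0 i *: delta_mx 0 i.
  by apply/funext => v; apply: row_sum_delta.
rewrite (rowE f) (rowE df); apply: is_diff_sum => i.
exact: (is_diff_comp (fdf i) (is_diff_scalel _ _)).
Qed.

Lemma is_diff_coord n (z : 'rV[K]_n) j :
  is_diff z (fun w : 'rV[K]_n => w 0 j : K) (fun v => v 0 j).
Proof.
pose c (w : 'rV[K]_n) : K := w 0 j.
have c_lin : linear c by move=> a u v; rewrite /c !mxE.
pose cM := GRing.isLinear.Build _ _ _ _ _ c_lin.
pose cL : {linear _ -> _} := HB.pack c cM.
by split; [apply: differentiable_coord|apply: (@diff_lin _ _ _ cL); apply: coord_continuous].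
Qed.

(* [L] is the differential of [log f] at [x], without choosing a branch. *)
Definition log_diff x f L := is_diff x f (fun v => f x * L v).

Lemma log_diff_eq x f g Lf Lg : log_diff x f Lf -> f =1 g -> Lf =1 Lg ->
  log_diff x g Lg.
Proof. by move=> + /funext <- /funext <-. Qed.

Lemma log_diff1 x : log_diff x (fun=> 1) (fun=> 0).
Proof. by apply: is_diff_eq; apply/funext => v; rewrite mulr0. Qed.

Lemma log_diffM x f g Lf Lg : log_diff x f Lf -> log_diff x g Lg ->
  log_diff x (fun v => f v * g v) (fun v => Lf v + Lg v).
Proof.
move=> fL gL; apply: (is_diff_eq (is_diffM fL gL)); apply/funext => v.
by change (f x * (g x * Lg v) + g x * (f x * Lf v) = f x * g x * (Lf v + Lg v)); ring.
Qed.

Lemma log_diffX x f Lf n : log_diff x f Lf ->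
  log_diff x (fun v => f v ^+ n) (fun v => n%:R * Lf v).
Proof.
move=> fL; elim: n => [|n IH].
  by apply: log_diff_eq (log_diff1 x) _ _ => v; rewrite (expr0, mul0r).
apply: log_diff_eq (log_diffM fL IH) _ _ => v; first by rewrite exprS.
by rewrite -natr1 mulrDl mul1r addrC.
Qed.

Lemma log_diff_prod x (I : Type) (r : seq I) (F L : I -> V -> K) :
  (forall i, log_diff x (F i) (L i)) ->
  log_diff x (fun v => \prod_(i <- r) F i v) (fun v => \sum_(i <- r) L i v).
Proof.
move=> FL; elim: r => [|i r IH].
  by apply: log_diff_eq (log_diff1 x) _ _ => v; rewrite big_nil.
by apply: log_diff_eq (log_diffM (FL i) IH) _ _ => v; rewrite big_cons.
Qed.

Lemma is_diff_inv f df x : f x != 0 -> is_diff x f df ->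
  is_diff x (fun v => (f v)^-1) (fun v => - (f x) ^- 2 * df v).
Proof.
move=> fx0 [f_diff f_val]; split; first exact: differentiableV.
by rewrite diffV // f_val.
Qed.

Lemma log_diff_id x f df : f x != 0 -> is_diff x f df ->
  log_diff x f (fun v => (f x)^-1 * df v).
Proof. by move=> f0 f_diff; apply: is_diff_eq; apply/funext => v; rewrite mulVKf. Qed.

Lemma log_diff_inv_onem x f df : 1 - f x != 0 -> is_diff x f df ->
  log_diff x (fun v => (1 - f v)^-1) (fun v => (1 - f x)^-1 * df v).
Proof.
move=> f1 f_diff.
have d1 : is_diff x (fun v => 1 - f v) (fun v => - df v).
  apply: (is_diff_eq (is_diffB (is_diff_cst (1 : K) x) f_diff)).
  by apply/funext => v; apply: sub0r.
apply: (is_diff_eq (@is_diff_inv (fun v => 1 - f v) _ _ f1 d1)).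
by apply/funext => v; field.
Qed.

Lemma log_diff_onem_inv x f df : f x != 0 -> 1 - f x != 0 -> is_diff x f df ->
  log_diff x (fun v => 1 - (f v)^-1) (fun v => (f x * (f x - 1))^-1 * df v).
Proof.
move=> f0 f1 f_diff.
apply: (is_diff_eq (is_diffB (is_diff_cst (1 : K) x) (is_diff_inv f0 f_diff))).
apply/funext => v.
change (0 - (- (f x) ^- 2 * df v) = (1 - (f x)^-1) * ((f x * (f x - 1))^-1 * df v)).
by field; rewrite f0 -opprB oppr_eq0 f1.
Qed.

End LogDifferential.

Section GluingDifferential.
Variables (R : realType) (N : nat) (T : triangulation N).
Local Notation C := R[i].
Local Notation Cn := ('rV[C]_N : normedModType C).

Lemma log_diff_shape (s : 'I_3) (V : normedModType C) (f df : V -> C^o) (x : V) :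
  f x != 0 -> 1 - f x != 0 -> is_diff x f df ->
  log_diff x (fun v => shape s (f v)) (fun v => zeta s (f x) * df v).
Proof.
move=> f0 f1 f_diff; case: s => -[|[|[|//]]] ?.
- exact: (log_diff_id f0 f_diff).
- exact: (log_diff_inv_onem f1 f_diff).
- exact: (log_diff_onem_inv f0 f1 f_diff).
Qed.

(** Where g = 1, the differential of each component is its logarithmic differential. Tangent vectors
    are rows, hence the transpose. *)
Lemma is_diff_gluing_map (z : 'rV[C]_N) :
    (forall j, 0 < complex.Im (z 0 j)) -> gluing_map T z = const_mx 1 ->
  is_diff (z : Cn) (gluing_map T : Cn -> Cn) (mulmx^~ (log_jacobian T z)^T).
Proof.
move=> z_gt0 gz1; apply: (@is_diff_row _ Cn) => i.
have gi1 : \prod_j \prod_(s < 3) shape s (z 0 j) ^+ edge_count T s i j = 1.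
  by move/rowP: gz1 => /(_ i); rewrite !mxE.
rewrite [X in is_diff _ X](_ : _ = fun w : Cn =>
    \prod_j \prod_(s < 3) shape s (w 0 j) ^+ edge_count T s i j); last first.
  by apply/funext => w; rewrite mxE.
apply: is_diff_eq (_ : log_diff _ _ _) _.
  apply: log_diff_prod => j; apply: log_diff_prod => s; apply: log_diffX.
  have [z0 z1] := shape_neq0 (z_gt0 j).
  by apply: log_diff_shape => //; apply: is_diff_coord.
apply/funext => v /=; rewrite gi1 mul1r mxE; apply: eq_bigr => j _.
rewrite [in RHS]mxE /log_jacobian /zeta_diag !mul_mx_diag !mxE.
rewrite !big_ord_recl big_ord0 /= addr0 addrA.
have -> : lift ord0 ord0 = sz' by apply: val_inj.
have -> : lift ord0 (lift ord0 ord0) = sz'' by apply: val_inj.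
have -> : ord0 = sz by apply: val_inj.
ring.
Qed.

Lemma is_diff_cusp_map :
  is_diff (const_mx 1 : Cn) (@cusp_map R N : Cn -> C^o) (fun v => 2 * \sum_i v 0 i).
Proof.
apply: is_diff_eq (_ : log_diff _ _ _) _.
  apply: log_diff_prod => i; apply: log_diffX.
  rewrite /log_diff; apply: is_diff_eq (is_diff_coord _ i) _.
  by apply/funext => v; rewrite mxE mul1r.
apply/funext => v /=; rewrite [X in X * _]big1 => [|i _]; last by rewrite mxE expr1n.
by rewrite mul1r mulr_sumr.
Qed.
End GluingDifferential.

(** * The logarithm along a tangent direction *)

Section ComplexLog.
Variable R : realType.
Local Notation C := R[i].

Section Curve.
Variables (a b : R -> R) (t a' b' : R).
Hypotheses (a_diff : is_derive t 1 a a') (b_diff : is_derive t 1 b b').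
Hypothesis b_gt0 : 0 < b t.

Let r s := a s ^+ 2 + b s ^+ 2.

Let r_gt0 : 0 < r t.
Proof. by rewrite ltr_wpDl ?sqr_ge0 // exprn_gt0. Qed.

Let r_diff : is_derive t 1 r (2 * (a t * a' + b t * b')).
Proof.
have -> : r = a ^+ 2 + b ^+ 2 by [].
apply: (is_derive_eq (is_deriveD (is_deriveX 2 a_diff) (is_deriveX 2 b_diff))).
by rewrite /GRing.scale /= !expr1; ring.
Qed.

Let Nr := Num.sqrt \o r.

Let Nr_gt0 : 0 < Nr t.
Proof. by rewrite sqrtr_gt0. Qed.

Let Nr_sqr : Nr t ^+ 2 = r t.
Proof. by rewrite sqr_sqrtr // ltW. Qed.

Let Nr_diff : is_derive t 1 Nr ((a t * a' + b t * b') / Nr t).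
Proof.
apply: (is_derive_eq (is_derive1_comp (is_derive1_sqrt r_gt0) r_diff)).
by rewrite -[Num.sqrt (r t)]/(Nr t); field; rewrite gt_eqF.
Qed.

Lemma is_derive_Re_Clog :
  is_derive t 1 (fun s => complex.Re (Clog (Complex (a s) (b s))))
    ((a t * a' + b t * b') / (a t ^+ 2 + b t ^+ 2)).
Proof.
have -> : (fun s => complex.Re (Clog (Complex (a s) (b s)))) = @ln R \o Nr.
  by apply/funext => s.
apply: (is_derive_eq (is_derive1_comp (is_derive1_ln Nr_gt0) Nr_diff)).
by rewrite -/(r t) -Nr_sqr; field; rewrite gt_eqF.
Qed.

(** Above the real axis the argument is acos (a / |w|), and the square root in the derivative of
    acos is b / |w| because b > 0. *)
Lemma is_derive_Im_Clog :
  is_derive t 1 (fun s => complex.Im (Clog (Complex (a s) (b s))))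
    ((a t * b' - b t * a') / (a t ^+ 2 + b t ^+ 2)).
Proof.
have b_near : \forall s \near t, 0 < b s.
  have b_cont : {for t, continuous b}.
    by apply/differentiable_continuous/derivable1_diffP; case: b_diff.
  exact: (cvgr_gt _ b_cont).
pose q : R -> R := a * (fun s => (Nr s)^-1).
apply: (@near_eq_is_derive _ _ _ (@acos R \o q)).
  near=> s; rewrite /= /Carg /= ifT //; apply: ltW; near: s; exact: b_near.
have Nr0 : Nr t != 0 by rewrite gt_eqF.
have q_diff : is_derive t 1 q (b t * (b t * a' - a t * b') / Nr t ^+ 3).
  apply: (is_derive_eq (is_deriveM a_diff (is_deriveV Nr0 Nr_diff))).
  rewrite /GRing.scale /=; apply/eqP; rewrite -subr_eq0.
  have -> : b t * (b t * a' - a t * b') = Nr t ^+ 2 * a' - a t * (a t * a' + b t * b').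
    by rewrite Nr_sqr /r; ring.
  by apply/eqP; field.
have sqr_q : 1 - q t ^+ 2 = (b t / Nr t) ^+ 2.
  rewrite -[q t]/(a t * (Nr t)^-1) !exprMn !exprVn Nr_sqr /r; field.
  by rewrite -/(r t) gt_eqF.
have q_lt1 : -1 < q t < 1.
  rewrite -ltr_norml -(@ltr_pXn2r _ 2) ?nnegrE // expr1n real_normK ?num_real //.
  by rewrite -subr_gt0 sqr_q exprn_gt0 // divr_gt0.
apply: (is_derive_eq (is_derive1_comp (is_derive1_acos q_lt1) q_diff)).
rewrite sqr_q sqrtr_sqr gtr0_norm ?divr_gt0 // -/(r t) -Nr_sqr.
by field; rewrite Nr0 gt_eqF.
Unshelve. all: by end_near. Qed.
End Curve.
End ComplexLog.

(** * Holomorphic functions at real increments *)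

Section RealSlice.
Variable R : realType.
Local Notation C := R[i].

Lemma real_complex_shift_cvg (u : C^o) :
  (fun s : R => s%:C%C + u : C^o) @ (0 : R) --> u.
Proof.
(* A positive complex number is real, so the real part of [e] serves as a radius in [R]. *)
move=> P [e /= e_gt0 eP]; exists (complex.Re e) => /=.
  by case: e e_gt0 {eP} => x y; rewrite ltcE /= => /andP[].
move=> s /= s_lt; apply: eP; move: s_lt; rewrite /= opprD addrCA subrr addr0 sub0r !normrN.
rewrite normc_def /= expr0n addr0 sqrtr_sqr.
by case: e e_gt0 => x y; rewrite !ltcE /= => /andP[/eqP-> _] ->; rewrite eqxx.
Qed.

Lemma real_complex_cvg0 : (fun s : R => s%:C%C : C^o) @ (0 : R)^' --> (0 : C^o)^'.
Proof.
move=> P P0; change (\forall s \near (0 : R), s != 0 -> P (s%:C%C : C^o)).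
have : \forall s \near (0 : R), s%:C%C + 0 != 0 :> C -> P (s%:C%C + 0 : C^o).
  exact: real_complex_shift_cvg P0.
apply: filterS => s.
by rewrite addr0 => sP s0; apply: sP; rewrite eq_complex /= eqxx andbT.
Qed.

(** [part] stands for the real or imaginary part. It commutes with real scalars and is 1-Lipschitz,
    so it carries the limit of the complex difference quotient to that of the real one. *)
Lemma is_derive_real_slice (part : {additive C -> R}) (f : C^o -> C^o) (u : C^o) :
    (forall (s : R) z, part (s%:C%C * z) = s * part z) ->
    (forall z, `|part z|%:C%C <= `|z|) ->
  differentiable f u ->
  is_derive (0 : R) 1 (fun s : R => part (f (s%:C%C + u))) (part ('d f u 1)).
Proof.
move=> partZ part_le f_diff.
have part_cont (z : C^o) : (part : C^o -> R) @ z --> part z.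
  move=> P [e /= e_gt0 eP]; exists e%:C%C => /=; first by rewrite ltcR.
  move=> w /= zw; apply: eP => /=; rewrite -raddfB -ltcR; exact: le_lt_trans zw.
have f_der : derivable f u 1 by apply: diff_derivable.
have f_cvg : (fun h : C^o => h^-1 *: (f (h *: 1 + u) - f u)) @ (0 : C^o)^' --> ('d f u 1).
  rewrite -deriveE //; exact: f_der.
have g_cvg : (fun h : R => h^-1 *: (part (f ((h *: 1 + 0)%:C%C + u)) - part (f (0%:C%C + u))))
    @ (0 : R)^' --> part ('d f u 1).
  have := cvg_comp _ _ (cvg_comp _ _ real_complex_cvg0 f_cvg) (part_cont _).
  apply: cvg_trans; apply: near_eq_cvg; near=> h.
  rewrite /= -raddfB /= addr0 add0r /GRing.scale /= !mulr1 -partZ.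
  by rewrite fmorphV.
by split; [apply/cvg_ex; exists (part ('d f u 1))|apply: cvg_lim].
Unshelve. all: by end_near. Qed.

End RealSlice.

Section LogParameter.
Variable R : realType.
Local Notation C := R[i].

(** Inversion reverses the sign of the imaginary part. All three shapes thus stay where the
    derivative of [Clog] was computed. *)
Lemma Im_shape_gt0 s (z : C) : 0 < complex.Im z -> 0 < complex.Im (shape s z).
Proof.
move=> z_gt0; have [z0 z1] := shape_neq0 z_gt0.
rewrite complex_Im_gt0 in z_gt0.
case: s => -[|[|[|//]]] ?; rewrite complex_Im_gt0 /shape //=.
  by rewrite ImV raddfB /= (Creal_ImP _ (rpred1 _)) sub0r opprK
    divr_gt0 // exprn_gt0 // normr_gt0.
by rewrite raddfB /= (Creal_ImP _ (rpred1 _)) ImV sub0r mulNr opprK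
  divr_gt0 // exprn_gt0 // normr_gt0.
Qed.

Lemma Re_le_norm (z : C) : `|complex.Re z|%:C%C <= `|z|.
Proof. by rewrite normc_def lecR -sqrtr_sqr ler_wsqrtr // lerDl sqr_ge0. Qed.

Lemma Im_le_norm (z : C) : `|complex.Im z|%:C%C <= `|z|.
Proof. by rewrite normc_def lecR -sqrtr_sqr ler_wsqrtr // lerDr sqr_ge0. Qed.

Lemma Re_scale (s : R) (z : C) : complex.Re (s%:C%C * z) = s * complex.Re z.
Proof. by case: z => x y /=; rewrite mul0r subr0. Qed.

Lemma Im_scale (s : R) (z : C) : complex.Im (s%:C%C * z) = s * complex.Im z.
Proof. by case: z => x y /=; rewrite mul0r addr0. Qed.

(* Restricting to real increments of [t] leaves only one-variable real calculus
   for the branch of the logarithm fixed by [Clog]. *)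
Lemma is_derive_Clog_slice (w : C^o -> C^o) (u : C^o) (L : C -> C) :
    0 < complex.Im (w u) -> log_diff u w L ->
  is_derive (0 : R) 1 (fun s : R => complex.Re (Clog (w (s%:C%C + u)))) (complex.Re (L 1))
  /\ is_derive (0 : R) 1 (fun s : R => complex.Im (Clog (w (s%:C%C + u)))) (complex.Im (L 1)).
Proof.
move=> w_gt0 [w_diff dw].
have aD := is_derive_real_slice Re_scale Re_le_norm w_diff.
have bD := is_derive_real_slice Im_scale Im_le_norm w_diff.
have b_gt0 : 0 < complex.Im (w ((0 : R)%:C%C + u)) by rewrite add0r.
have r0 : complex.Re (w u) ^+ 2 + complex.Im (w u) ^+ 2 != 0.
  by rewrite gt_eqF // ltr_wpDl ?sqr_ge0 // exprn_gt0.
have dw1 : 'd w u 1 = w u * L 1 by rewrite dw.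
have wsE (part : C -> R) : (fun s : R => part (Clog (w (s%:C%C + u)))) = (fun s : R =>
    part (Clog (Complex (complex.Re (w (s%:C%C + u))) (complex.Im (w (s%:C%C + u)))))).
  by apply/funext => s; case: (w _).
rewrite !wsE; have := is_derive_Re_Clog aD bD b_gt0.
have := is_derive_Im_Clog aD bD b_gt0; rewrite dw1 !add0r.
move: r0 {wsE dw dw1 w_diff aD bD b_gt0}.
case: (w u) w_gt0 => x y; case: (L 1) => l1 l2 /= y_gt0 r0 imD reD.
split.
  by apply: (is_derive_eq reD); field.
by apply: (is_derive_eq imD); field.
Qed.

End LogParameter.

Section RealDerivative.
Variables (R : realType) (t : R).

Lemma is_derive_sumE n (f : 'I_n -> R -> R) (df : 'I_n -> R) :
    (forall i, is_derive t (1 : R) (f i) (df i)) ->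
  is_derive t (1 : R) (fun s => \sum_i f i s) (\sum_i df i).
Proof.
move=> fdf; have -> : (fun s => \sum_i f i s) = \sum_i f i.
  by apply/funext => s; rewrite fct_sumE.
exact: is_derive_sum.
Qed.

Lemma is_derive_mulrz (f : R -> R) (df : R) (c : int) :
  is_derive t (1 : R) f df -> is_derive t (1 : R) (fun s => f s *~ c) (df *~ c).
Proof.
move=> fdf; have -> : (fun s => f s *~ c) = (c%:~R : R) *: f.
  by apply/funext => s; rewrite -[RHS]/(c%:~R * f s) mulrzl.
by apply: is_derive_eq; rewrite /GRing.scale /= mulrzl.
Qed.

End RealDerivative.

(** * The tangent vector of the local inverse *)

Section Tangent.
Variables (R : realType) (N : nat) (T : triangulation N).
Local Notation C := R[i].
Local Notation Cn := ('rV[C]_N : normedModType C).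
Variables (y : C^o -> 'rV[C]_N) (u : C^o).
Hypothesis y_diff : differentiable (y : C^o -> Cn) u.
Hypothesis y_gt0 : forall j, 0 < complex.Im (y u 0 j).

(** The composite of g and [y] is constant near [u]; apply the chain rule. *)
Lemma tangent_gluing_map : gluing_map T (y u) = const_mx 1 ->
    (\forall t \near u, gluing_map T (y t) = const_mx 1) ->
  'd (y : C^o -> Cn) u 1 *m (log_jacobian T (y u))^T = 0.
Proof.
move=> gyu gy.
have [g_diff dg] := is_diff_gluing_map y_gt0 gyu.
have gy_diff : differentiable ((gluing_map T : Cn -> Cn) \o (y : C^o -> Cn)) u.
  exact: differentiable_comp.
rewrite -[LHS]/((mulmx^~ (log_jacobian T (y u))^T) ('d (y : C^o -> Cn) u 1)) -dg.
rewrite -[LHS]/(('d (gluing_map T : Cn -> Cn) (y u : Cn) \o 'd (y : C^o -> Cn) u) 1).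
rewrite -diff_comp // -deriveE //.
rewrite (@near_eq_derive _ _ _ _ (cst (const_mx 1 : Cn))) //.
exact: derive_cst.
Qed.

(** The left side is Du on the derivative of [y]. Real and imaginary parts are treated alike, by
    differentiating at real increments of [t]. *)
Lemma tangent_log_parameter (th : normal_curve T R) :
    (\forall t \near u, log_parameter th (y t) = t) ->
  \sum_j \sum_(s < 3)
    (zeta s (y u 0 j) * 'd (y : C^o -> Cn) u 1 0 j) *~ corner_count th s j = 1.
Proof.
move=> y_log.
have w_diff s j : log_diff u (fun t => shape s (y t 0 j))
    (fun v => zeta s (y u 0 j) * 'd (y : C^o -> Cn) u v 0 j).
  have [z0 z1] := shape_neq0 (y_gt0 j).
  apply: (@log_diff_shape _ s _ (fun t => y t 0 j)) => //.
  apply: (is_diff_comp (f := y : C^o -> Cn) (df := 'd (y : C^o -> Cn) u) _ (is_diff_coord (y u) j)).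
  exact: differentiableP.
have slice s j := is_derive_Clog_slice (w := fun t => shape s (y t 0 j))
  (Im_shape_gt0 s (y_gt0 j)) (w_diff s j).
have partE (part : {additive C -> R}) :
    (forall s : R, part s%:C%C = s * part 1) ->
    (forall s j, is_derive (0 : R) 1
       (fun r : R => part (Clog (shape s (y (r%:C%C + u) 0 j))))
       (part (zeta s (y u 0 j) * 'd (y : C^o -> Cn) u 1 0 j))) ->
  part (\sum_j \sum_(s < 3)
    (zeta s (y u 0 j) * 'd (y : C^o -> Cn) u 1 0 j) *~ corner_count th s j) = part 1.
  move=> partZ part_slice.
  rewrite raddf_sum; under eq_bigr do rewrite raddf_sum.
  pose F (r : R) := part (log_parameter th (y (r%:C%C + u))).
  have F_der : is_derive (0 : R) 1 F (\sum_j \sum_(s < 3)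
      part (zeta s (y u 0 j) * 'd (y : C^o -> Cn) u 1 0 j) *~ corner_count th s j).
    have -> : F = fun r : R => \sum_j \sum_(s < 3)
        part (Clog (shape s (y (r%:C%C + u) 0 j))) *~ corner_count th s j.
      apply/funext => r; rewrite /F raddf_sum; apply: eq_bigr => j _.
      by rewrite raddf_sum; apply: eq_bigr => s _; rewrite mulrzl raddfMz.
    apply: is_derive_sumE => j; apply: is_derive_sumE => s.
    exact: is_derive_mulrz.
  (* The same function is affine near 0, with slope [part 1]; the two derivatives must agree. *)
  have F_der' : is_derive (0 : R) 1 F (part 1).
    pose G (r : R) := r * part 1 + part u.
    apply: (@near_eq_is_derive _ _ _ G).
      have : \forall r \near (0 : R), log_parameter th (y (r%:C%C + u)) = r%:C%C + u.
        exact: real_complex_shift_cvg y_log.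
      apply: filterS => r ry; rewrite /F ry.
      by rewrite /G -partZ -raddfD.
    have -> : G = (part 1) *: (id : R -> R) + cst (part u).
      by apply/funext => r; rewrite /G mulrC.
    by apply: is_derive_eq; rewrite addr0 /GRing.scale /= mulr1.
  under eq_bigr do under eq_bigr do rewrite raddfMz.
  by rewrite -(derive_val (is_derive := F_der)) derive_val.
apply/eqP; rewrite eq_complex; apply/andP; split; apply/eqP.
  by apply: (partE (@complex.Re R)) => [r|s j]; [rewrite /= mulr1|have [] := slice s j].
by apply: (partE (@complex.Im R)) => [r|s j]; [rewrite /= mulr0|have [] := slice s j].
Qed.

End Tangent.

(** * Acyclicity and torsion *)

Section TorsionGeneralities.
Variable K : fieldType.

(** The inclusion from right to left needs one admissible choice: canonical bases, lifted by the
    pseudo-inverses of the differentials. *)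
Lemma torsion_pm n (X : cochain K) (c : forall i, seq (obj X i)) (x : K) :
    (forall b s : forall i, seq (obj X i),
      (forall i, basis_of (coboundaries X i) (b i)) ->
      (forall i, map (dmap X i) (s i) = b i.+1) ->
      pm x (\prod_(i < n) change_det (b i ++ s i) (c i) ^ ((-1) ^+ i : int))) ->
  torsion n X c = pm x.
Proof.
move=> Px; apply/seteqP; split=> t.
  case=> b [s [bP sP]] /=.
  by case: (Px b s bP sP) => -> [] ->; rewrite ?opprK; [left|right|right|left].
move=> tx; pose b i : seq (obj X i) := vbasis (coboundaries X i).
pose s i := map (dmap X i)^-1%VF (b i.+1).
have bP i : basis_of (coboundaries X i) (b i) by apply: vbasisP.
have sP i : map (dmap X i) (s i) = b i.+1.
  rewrite -map_comp map_id_in // => v vb /=; rewrite limg_lfunVK //.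
  by rewrite -/(coboundaries X i.+1); apply: (basis_mem (bP i.+1)).
exists b, s; split=> //=.
by case: (Px b s bP sP) tx => -> [] ->; rewrite ?opprK; [left|right|right|left].
Qed.

Lemma det_cast_ord m n (e : m = n) (F : nat -> 'I_n -> K) :
  \det (\matrix_(i < m, l < m) F i (cast_ord e l)) = \det (\matrix_(i, l) F i l).
Proof.
case: n / e F => F; congr (\det _); apply/matrixP => i l; rewrite !mxE.
by congr (F _ _); apply: val_inj.
Qed.

(** Coordinates in the standard basis are entries; the size of the basis equals [n] only
    propositionally, hence the casts. *)
Lemma change_det_delta n (a : seq 'rV[K]_n) :
  change_det a [seq (delta_mx 0 j : 'rV[K]_n) | j : 'I_n]
  = \det (\matrix_(i < n, l < n) (a`_i : 'rV_n) 0 l).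
Proof.
set c := [seq (delta_mx 0 j : 'rV[K]_n) | j : 'I_n].
have sz_c : size c = n by rewrite size_image card_ord.
rewrite -(det_cast_ord sz_c (fun i l => (a`_i : 'rV_n) 0 l)).
congr (\det _); apply/matrixP => i l; rewrite !mxE.
have c_nth (k : 'I_(size c)) : (in_tuple c)`_k = delta_mx 0 (cast_ord sz_c k).
  have k_lt : (k < n)%N by rewrite -[X in (_ < X)%N]sz_c.
  rewrite /= /c (nth_map (cast_ord sz_c k)) ?size_enum_ord //.
  by rewrite (nth_ord_enum _ (cast_ord sz_c k)).
have c_sum (k : 'I_(size c) -> K) : \sum_i k i *: (in_tuple c)`_i
    = \row_j k (cast_ord (esym sz_c) j).
  rewrite [RHS]row_sum_delta (reindex (cast_ord sz_c)) /=; last first.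
    by apply: onW_bij; exists (cast_ord (esym sz_c)) => ?; apply: val_inj.
  by apply: eq_bigr => j _; rewrite c_nth mxE cast_ordK.
have c_free : free (in_tuple c).
  apply/freeP => k; rewrite c_sum => /rowP k0 j.
  by have := k0 (cast_ord sz_c j); rewrite !mxE cast_ordK.
rewrite -[in LHS](_ : \sum_j (a`_i : 'rV_n) 0 (cast_ord sz_c j) *: (in_tuple c)`_j = a`_i).
  by rewrite coord_sum_free.
by rewrite c_sum; apply/rowP => j; rewrite mxE cast_ordKV.
Qed.

Lemma change_det_1 (a : K^o) : change_det [:: a] [:: (1 : K^o)] = a.
Proof.
rewrite /change_det det_mx11 mxE /=.
have f1 : free (in_tuple [:: (1 : K^o)]) by rewrite seq1_free oner_eq0.
rewrite -[RHS](coord_sum_free (fun=> a : K) ord0 f1) big_ord1.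
by congr (coord _ _ _); rewrite -[RHS]/((a : K) * 1) mulr1.
Qed.

End TorsionGeneralities.

(** * Determinants of a Jacobian with its last row replaced *)

Section HatJacobian.
Variables (K : fieldType) (n : nat) (M H : 'M[K]_n.+1) (h : 'rV[K]_n.+1).
Hypothesis M_h : h *m M^T = 0.
Hypothesis one_M : (const_mx 1 : 'rV_n.+1) *m M = 0.
Hypothesis rank_M : (n <= \rank M)%N.
Hypothesis H_M : forall i l, i != ord_max -> H i l = M i l.
Hypothesis H_h : (h *m H^T) 0 ord_max = 1.

Lemma tangent_neq0 : h != 0.
Proof.
by apply/eqP => h0; move: H_h; rewrite h0 mul0mx mxE => /esym/eqP; rewrite oner_eq0.
Qed.

(** The rank bound makes the kernel at most a line, and it contains [h], which is nonzero. *)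
Lemma jacobian_kernel (v : 'rV_n.+1) : v *m M^T = 0 -> exists t, v = t *: h.
Proof.
move=> v0.
have h_ker : (h <= kermx M^T)%MS by apply/sub_kermxP.
have : (kermx M^T <= h)%MS.
  rewrite -(mxrank_leqif_sup h_ker) eqn_leq mxrankS //=.
  by rewrite mxrank_ker mxrank_tr rank_rV tangent_neq0 leq_subLR addn1.
have /sub_kermxP vk := v0.
by move/(submx_trans vk)/submxP => [c ->]; exists (c 0 0);
  rewrite [c in LHS]mx11_scalar mul_scalar_mx.
Qed.

Lemma sum_jacobian (v : 'rV[K]_n.+1) : \sum_i (v *m M^T) 0 i = 0.
Proof.
have -> : \sum_i (v *m M^T) 0 i = (((const_mx 1 : 'rV_n.+1) *m M) *m v^T) 0 (0 : 'I_1).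
  rewrite -mulmxA -[M]trmxK -trmx_mul trmxK mxE; apply: eq_bigr => i _.
  by rewrite [X in _ = X * _]mxE mul1r [RHS]mxE.
by rewrite one_M mul0mx mxE.
Qed.

(** The image lies in the hyperplane of coordinate sum zero and has at least its dimension [n]. *)
Lemma jacobian_image (v : 'rV_n.+1) :
  \sum_i v 0 i = 0 -> exists w, v = w *m M^T.
Proof.
move=> v0; pose e : 'cV[K]_n.+1 := const_mx 1.
have sumE (w : 'rV_n.+1) : w *m e = (\sum_i w 0 i)%:M.
  rewrite [LHS]mx11_scalar mxE; congr (_%:M); apply: eq_bigr => i _.
  by rewrite mxE mulr1.
have M_ker : (M^T <= kermx e)%MS.
  by apply/row_subP => i; apply/sub_kermxP; rewrite rowE sumE sum_jacobian raddf0.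
have : (kermx e <= M^T)%MS.
  rewrite -(mxrank_leqif_sup M_ker) eqn_leq mxrankS //= mxrank_ker mxrank_tr.
  have -> : \rank e = 1%N.
    rewrite -mxrank_tr rank_rV; case: eqP => // /rowP/(_ 0).
    by rewrite !mxE => /eqP; rewrite oner_eq0.
  by rewrite subn1.
have /sub_kermxP vk : v *m e = 0 by rewrite sumE v0 raddf0.
by move/(submx_trans vk)/submxP.
Qed.

Section Determinants.
Variables (a : K) (s : 'I_n -> 'rV[K]_n.+1) (w : 'rV[K]_n.+1).
(** [B1] and [B2] are the frames in degrees 1 and 2. The single vector is a coboundary, placed
    first, in [B1], and a lift, placed last, in [B2]. *)
Let B1 := \matrix_(i < n.+1, l < n.+1)
  (if unlift ord0 i is Some k then s k else a *: h) 0 l.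
Let B2 := \matrix_(i < n.+1, l < n.+1)
  (if unlift ord_max i is Some k then s k *m M^T else w) 0 l.
Let delta := \det (\matrix_(i < n, j < n) (s i *m M^T) 0 (lift ord_max j)).

Lemma det_target_frame : \det B2 = delta * \sum_i w 0 i.
Proof.
(* Multiplying by [E] adds all the other columns to the last one. *)
pose E : 'M[K]_n.+1 := \matrix_(k, l) ((l == ord_max) || (k == l))%:R.
have detE : \det E = 1.
  rewrite -det_tr det_trig; last first.
    apply/is_trig_mxP => i j ij; rewrite !mxE -!val_eqE /= (gtn_eqF ij) orbF.
    by rewrite ltn_eqF // (leq_trans ij) // -ltnS ltn_ord.
  by apply: big1 => i _; rewrite !mxE eqxx orbT.
have BE i l : (B2 *m E) i (lift ord_max l) = B2 i (lift ord_max l).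
  rewrite mxE (bigD1 (lift ord_max l)) //= big1 => [|k kl].
    by rewrite addr0 [E _ _]mxE eqxx orbT mulr1.
  by rewrite [E _ _]mxE (negPf kl) eq_sym (negPf (neq_lift _ _)) mulr0.
have BEm i : (B2 *m E) i ord_max = \sum_k B2 i k.
  by rewrite mxE; apply: eq_bigr => k _; rewrite [E _ _]mxE eqxx mulr1.
(* The rows M s_i have coordinate sum zero, so the last column keeps only its corner entry, whose
   cofactor sign is +. *)
rewrite -[LHS]mulr1 -detE -det_mulmx (expand_det_col _ ord_max).
rewrite (bigD1 ord_max) //= big1 => [|i]; last first.
  rewrite eq_sym => /unlift_some[k -> _]; rewrite BEm.
  under eq_bigr do rewrite mxE liftK.
  by rewrite sum_jacobian mul0r.
rewrite addr0 BEm mulrC; congr (_ * _).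
  rewrite /cofactor addnn -signr_odd odd_double expr0 mul1r.
  by congr (\det _); apply/matrixP => i j; rewrite [LHS]mxE [LHS]mxE BE [LHS]mxE liftK [RHS]mxE.
by apply: eq_bigr => k _; rewrite mxE unlift_none.
Qed.

(** The first row of B1 H^T is (0, ..., 0, a), and the other rows agree with M s_i off the last
    column; expand along the first row. *)
Lemma det_source_frame : \det B1 * \det H = (-1) ^+ n * (a * delta).
Proof.
have HE (v : 'rV_n.+1) l : (v *m H^T) 0 (lift ord_max l) = (v *m M^T) 0 (lift ord_max l).
  rewrite !mxE; apply: eq_bigr => k _; rewrite !mxE H_M //.
  by rewrite eq_sym neq_lift.
have BE i l : (B1 *m H^T) i l
    = ((if unlift ord0 i is Some k then s k else a *: h) *m H^T) 0 l.
  by rewrite !mxE; apply: eq_bigr => k _; rewrite mxE.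
rewrite -(det_tr H) -det_mulmx (expand_det_row _ ord0).
rewrite (bigD1 ord_max) //= big1 => [|l]; last first.
  rewrite eq_sym => /unlift_some[k -> _].
  by rewrite BE unlift_none HE -scalemxAl M_h scaler0 mxE mul0r.
rewrite addr0 BE unlift_none -scalemxAl mxE H_h mulr1 mulrCA; congr (_ * _).
rewrite /cofactor; congr (_ * \det _); apply/matrixP => i j.
by rewrite [LHS]mxE [LHS]mxE BE liftK HE [RHS]mxE.
Qed.

(** Applying [M] to a relation between the rows kills its term in [h] and hence all coefficients of
    the [s i]; then only a h is left. *)
Lemma det_source_frame_neq0 : a != 0 ->
    (forall c : 'I_n -> K, \sum_i c i *: (s i *m M^T) = 0 -> forall i, c i = 0) ->
  \det B1 != 0.
Proof.
move=> a0 s_free; apply/det0P => -[v v0 vB].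
have vE : v 0 ord0 *: (a *: h) + \sum_i v 0 (lift ord0 i) *: s i = 0.
  rewrite -[RHS]vB; apply/rowP => l; rewrite [LHS]mxE summxE [RHS]mxE big_ord_recl.
  congr (_ + _); first by rewrite [LHS]mxE [X in _ = _ * X]mxE unlift_none.
  by apply: eq_bigr => i _; rewrite [LHS]mxE [X in _ = _ * X]mxE liftK.
have vl i : v 0 (lift ord0 i) = 0.
  apply: (s_free (fun i => v 0 (lift ord0 i))).
  have := congr1 (mulmx^~ M^T) vE; rewrite mulmxDl -!scalemxAl M_h !scaler0 add0r.
  rewrite mulmx_suml mul0mx => E; rewrite -[RHS]E.
  by apply: eq_bigr => k _; rewrite scalemxAl.
move: vE; rewrite big1 => [|i _]; last by rewrite vl scale0r.
rewrite addr0 => /eqP; rewrite !scaler_eq0 (negPf a0) (negPf tangent_neq0) !orbF.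
move=> /eqP vh; case/eqP: v0; apply/rowP => i; rewrite mxE.
by case: (unliftP ord0 i) => [k|] ->.
Qed.

End Determinants.
End HatJacobian.

Section AcyclicDim.
Variables (K : fieldType) (X : cochain K).
Hypothesis X_acyclic : acyclic X.

Lemma dim_coboundariesS i :
  (\dim (coboundaries X i) + \dim (coboundaries X i.+1) = \dim {:obj X i})%N.
Proof.
by rewrite -(X_acyclic i) /= -[in RHS](limg_ker_dim (dmap X i) fullv) capfv.
Qed.

End AcyclicDim.

(** * Exactness and torsion of the gluing complex *)

Section GluingTorsion.
Variables (R : realType) (n : nat) (T : triangulation n.+1).
Local Notation C := R[i].
Variables (y : C^o -> 'rV[C]_n.+1) (t : C^o) (M H : 'M[C]_n.+1) (h : 'rV[C]_n.+1).
Let X := gluing_complex T y t.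
Hypothesis d0E : forall a : C^o, dmap X 0 a = a *: h.
Hypothesis d1E : forall v : 'rV[C]_n.+1, dmap X 1 v = v *m M^T.
Hypothesis d2E : forall v : 'rV[C]_n.+1, dmap X 2 v = 2 * \sum_i v 0 i.
Hypothesis M_h : h *m M^T = 0.
Hypothesis one_M : (const_mx 1 : 'rV_n.+1) *m M = 0.
Hypothesis rank_M : (n <= \rank M)%N.
Hypothesis H_M : forall i l, i != ord_max -> H i l = M i l.
Hypothesis H_h : (h *m H^T) 0 ord_max = 1.

Let h_neq0 : h != 0 := tangent_neq0 H_h.
Let two_neq0 : (2 : C) != 0.
Proof. by rewrite pnatr_eq0. Qed.

Lemma gluing_acyclic : acyclic X.
Proof.
case=> [|[|[|i]]]; apply/vspaceP => v; rewrite memv_ker /coboundaries.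
- by rewrite d0E scaler_eq0 (negPf h_neq0) orbF memv0.
- apply/eqP/memv_imgP => [|[a _ ->]]; rewrite d1E.
    move=> /(jacobian_kernel M_h rank_M H_h) [a va].
    by exists a; rewrite ?memvf // d0E.
  by rewrite d0E -scalemxAl M_h scaler0.
- apply/eqP/memv_imgP => [|[w _ ->]]; rewrite d2E.
    move/eqP; rewrite mulf_eq0 (negPf two_neq0) /= => /eqP.
    case/(jacobian_image one_M rank_M) => w vw.
    by exists w; rewrite ?memvf // d1E.
  by rewrite d1E sum_jacobian // mulr0.
case: i v => [|i] v.
  rewrite lfunE /= eqxx; apply/esym/memv_imgP.
  (* The last differential is twice the coordinate sum, so half of [v] on one basis vector is a
     preimage. *)
  exists (2^-1 * (v : C) *: delta_mx 0 0 : 'rV[C]_n.+1); rewrite ?memvf // d2E.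
  rewrite (bigD1 0) //= big1 => [|i i0]; last by rewrite !mxE (negPf i0) mulr0.
  by rewrite addr0 !mxE !eqxx mulr1 mulVKf.
have -> : v = 0 by apply: (thinmx0 (v : 'rV[C]_0)).
by rewrite !mem0v linear0 eqxx.
Qed.

(** The coboundaries have dimensions 0, 1, n, 1, 0, so any choice consists of one lift [a], then [n]
    lifts, then one lift [w], and the two frame determinants apply. *)
Lemma gluing_torsion :
  torsion 4 X (gluing_basis R n.+1) = pm (2^-1 * \det H).
Proof.
have dimB := dim_coboundariesS gluing_acyclic.
have dim0 : \dim (coboundaries X 0) = 0%N by rewrite dimv0.
have dim_rV : \dim {:'rV[C]_n.+1} = n.+1 by rewrite dimvf /dim /= mul1n.
have dim_C : \dim {:C^o} = 1%N by rewrite dimvf.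
have dim1 : \dim (coboundaries X 1) = 1%N.
  by apply: etrans dim_C; rewrite -[RHS](dimB 0%N) dim0.
have dim2 : \dim (coboundaries X 2) = n.
  by apply/eqP; rewrite -(eqn_add2l 1); rewrite -{1}dim1 (dimB 1%N); apply/eqP.
have dim3 : \dim (coboundaries X 3) = 1%N.
  apply/eqP; rewrite -(eqn_add2l n) -{1}dim2 (dimB 2%N) addn1; exact/eqP.
have dim4 : \dim (coboundaries X 4) = 0%N.
  by apply/eqP; rewrite -(eqn_add2l 1) -{1}dim3 (dimB 3%N); apply/eqP.
apply: torsion_pm => b s bP sP.
have size_b i : size (b i) = \dim (coboundaries X i).
  by rewrite (size_basis (X := in_tuple (b i)) (bP i)).
have size_s i : size (s i) = \dim (coboundaries X i.+1).
  by rewrite -size_b -sP size_map.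
have b0 : b 0%N = [::] by apply: size0nil; rewrite size_b.
have s3 : s 3%N = [::] by apply: size0nil; rewrite size_s.
have [a s0] : exists a : C^o, s 0%N = [:: a].
  have := size_s 0%N; rewrite dim1; case: (s 0%N) => [|a [|//]] // _.
  by exists a.
have b1 : b 1%N = [:: a *: h] by rewrite -sP s0 /= d0E.
have [w s2] : exists w : 'rV[C]_n.+1, s 2%N = [:: w].
  have := size_s 2%N; rewrite dim3; case: (s 2%N) => [|w [|//]] // _.
  by exists w.
have b3 : b 3%N = [:: 2 * \sum_i w 0 i : C^o] by rewrite -sP s2 /= d2E.
have a0 : a != 0.
  have := basis_free (bP 1%N); rewrite b1 seq1_free scaler_eq0 negb_or.
  by case/andP.
have w0 : \sum_i w 0 i != 0.
  have := basis_free (bP 3%N); rewrite b3 seq1_free mulf_eq0 negb_or.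
  by case/andP.
pose s1 (i : 'I_n) : 'rV[C]_n.+1 := (s 1%N)`_i.
have b2 (i : 'I_n) : (b 2%N)`_i = s1 i *m M^T.
  by rewrite -sP (nth_map 0) ?size_s ?dim2 // d1E.
pose delta := \det (\matrix_(i < n, j < n) (s1 i *m M^T) 0 (lift ord_max j)).
pose B1 := \matrix_(i < n.+1, l < n.+1)
  (if unlift ord0 i is Some k then s1 k else a *: h) 0 l.
have P0 : change_det (b 0%N ++ s 0%N) (gluing_basis R n.+1 0) = a.
  by rewrite b0 s0; apply: change_det_1.
have P1 : change_det (b 1%N ++ s 1%N) (gluing_basis R n.+1 1) = \det B1.
  rewrite b1; apply: etrans (change_det_delta _) _; congr (\det _).
  apply/matrixP => i l; rewrite [LHS]mxE [RHS]mxE.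
  by case: unliftP => [k|] ->.
have P2 : change_det (b 2%N ++ s 2%N) (gluing_basis R n.+1 2) = delta * \sum_i w 0 i.
  rewrite s2 -(det_target_frame one_M).
  apply: etrans (change_det_delta _) _; congr (\det _).
  apply/matrixP => i l; rewrite [LHS]mxE [RHS]mxE nth_cat.
  rewrite (_ : size _ = n); last exact: etrans (size_b 2%N) dim2.
  case: unliftP => [k|] ->; last by rewrite /= ltnn subnn.
  by rewrite lift_max ltn_ord -b2.
have P3 : change_det (b 3%N ++ s 3%N) (gluing_basis R n.+1 3) = 2 * \sum_i w 0 i.
  by rewrite b3 s3; apply: change_det_1.
have B1_neq0 : \det B1 != 0.
  apply: (det_source_frame_neq0 M_h H_h a0) => c c0.
  have sz2 : size (b 2%N) = n by rewrite size_b.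
  have : free (Tuple (introT eqP sz2)) by apply: basis_free (bP 2%N).
  move/vector.freeP/(_ c); apply; rewrite -[RHS]c0.
  by apply: eq_bigr => i _; rewrite -b2.
have dH : \det H = (-1) ^+ n * (a * delta / \det B1).
  apply: (mulfI B1_neq0); rewrite (det_source_frame M_h H_M H_h).
  by rewrite [RHS]mulrC -!mulrA mulVf // mulr1.
have prod4 (F : nat -> C) : \prod_(i < 4) F i = F 0%N * F 1%N * F 2%N * F 3%N.
  by rewrite !big_ord_recr big_ord0 /= mul1r.
rewrite (prod4 (fun i => change_det (b i ++ s i) (gluing_basis R n.+1 i) ^ ((-1) ^+ i : int))).
rewrite P0 P1 P2 P3 -[(-1) ^+ 0]/(1 : int) -[(-1) ^+ 1]/(-1 : int).
rewrite -[(-1) ^+ 2]/(1 : int) -[(-1) ^+ 3]/(-1 : int) !expr1z -!invr_expz !expr1z.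
(* The coordinate sum of [w] cancels between degrees 2 and 3 and leaves the factor 1/2. *)
have -> : (a : C) * (\det B1)^-1 * (delta * \sum_i w 0 i) * (2 * \sum_i w 0 i)^-1
   = (-1) ^+ n * (2^-1 * \det H).
  rewrite dH [2^-1 * _]mulrCA [RHS]mulrA -[_ * _ ^+ n]expr2 sqrr_sign mul1r.
  by field; rewrite w0 B1_neq0.
rewrite -signr_odd /pm /=; case: (odd n); rewrite ?mul1r ?mulN1r; by [left|right].
Qed.

End GluingTorsion.

(** Without tetrahedra the link is empty and has no component. *)
Lemma one_cusp_nonempty N (T : triangulation N) : one_cusp T -> exists n, N = n.+1.
Proof.
case: N T => [|n] T; last by exists n.
by move=> /eqP/card1P [[[]]].
Qed.

Lemma mulr_sum3_intmul (K : comPzRingType) (a x1 x2 x3 : K) (c1 c2 c3 : int) :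
  a * (c1%:~R * x1 + c2%:~R * x2 + c3%:~R * x3)
  = x1 * a *~ c1 + (x2 * a *~ c2 + x3 * a *~ c3).
Proof. by rewrite -(mulrzl (x1 * a)) -(mulrzl (x2 * a)) -(mulrzl (x3 * a)); ring. Qed.

Theorem lemma5p1 (R : realType) (N : nat) (T : triangulation N)
    (cusp : one_cusp T)
    (th : normal_curve T R) (th_nontrivial : ~ homotopically_trivial th)
    (zs : 'rV[R[i]]_N) (zs_complete : complete_solution th zs)
    (U : set R[i]^o) (y : R[i]^o -> 'rV[R[i]]_N)
    (y_inverse : local_inverse th zs U y)
    (u : R[i]^o) (Uu : U u) :
  acyclic (gluing_complex T y u) /\
  torsion 4 (gluing_complex T y u) (gluing_basis R N)
    = pm (2^-1 * \det (hat_matrix th sz *m zeta_diag sz (y u)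
                       + hat_matrix th sz' *m zeta_diag sz' (y u)
                       + hat_matrix th sz'' *m zeta_diag sz'' (y u))).
Proof.
have [n Nn] := one_cusp_nonempty cusp; subst N.
case: y_inverse => [[U_open _] y_diff [W [_ yP _]]].
have U_near : \forall t \near u, U t by apply: open_nbhs_nbhs.
have [[y_gt0 gyu] _ _] := yP u Uu.
have gy : \forall t \near u, gluing_map T (y t) = const_mx 1.
  by apply: filterS U_near => t /yP [[]].
have y_log : \forall t \near u, log_parameter th (y t) = t.
  by apply: filterS U_near => t /yP [].
have M_h := tangent_gluing_map (y_diff _ Uu) y_gt0 gyu gy.
have l_h := tangent_log_parameter (y_diff _ Uu) y_gt0 y_log.
have [g_diff dg] := is_diff_gluing_map y_gt0 gyu.
have [p_diff dp] := is_diff_cusp_map R n.+1.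
set H := (_ + _ + _)%R.
set h := ('d y u 1) in M_h l_h.
have d0E (a : R[i]^o) : dmap (gluing_complex T y u) 0 a = a *: h.
  by rewrite /= lfunE /= -linearZ /= [_ *: _]mulr1.
have d1E (v : 'rV[R[i]]_n.+1) : dmap (gluing_complex T y u) 1 v = v *m (log_jacobian T (y u))^T.
  by rewrite /= lfunE /= dg.
have d2E (v : 'rV[R[i]]_n.+1) : dmap (gluing_complex T y u) 2 v = 2 * \sum_i v 0 i.
  by rewrite /= lfunE /= dp.
have one_M := const_mul_log_jacobian T y_gt0.
have rank_M : (n <= \rank (log_jacobian T (y u)))%N by rewrite -ltnS; apply: rank_log_jacobian.
(* All rows but the last are edge rows; the last one is Du, so the next claim is [l_h]. *)
have H_M (i l : 'I_n.+1) : i != ord_max -> H i l = log_jacobian T (y u) i l.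
  move=> i_max; rewrite /H /log_jacobian /zeta_diag !mul_mx_diag !mxE /=.
  by rewrite (_ : (i == n :> nat) = false) //; apply: negPf.
have H_h : (h *m H^T) 0 ord_max = 1.
  rewrite -l_h mxE; apply: eq_bigr => j _.
  rewrite /H /zeta_diag !mul_mx_diag !mxE /= eqxx.
  rewrite !big_ord_recl big_ord0 /= addr0.
  have -> : lift ord0 ord0 = sz' by apply: val_inj.
  have -> : lift ord0 (lift ord0 ord0) = sz'' by apply: val_inj.
  have -> : ord0 = sz by apply: val_inj.
  exact: mulr_sum3_intmul.
split; first exact: (gluing_acyclic d0E d1E d2E M_h one_M rank_M H_h).
exact: (gluing_torsion d0E d1E d2E M_h one_M rank_M H_M H_h).
Qed.
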